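(* Let $n$ be a positive integer and let $P$ be a complex polynomial of degree $n$. Then for all $\alpha,\gamma\in\mathbb{C}$ with $\Re(\alpha)\leq \frac{n}{2}$ and $\Re(\gamma)\leq \frac{n}{2}$, and every $0\leq p<\infty$, $$\left\|zP'(z)-\alpha P(z)\right\|_p\leq |n-\alpha|\,\left\|P(z)\right\|_p$$ and $$\left\|z^2P''(z)+(1-\alpha-\gamma)zP'(z)+\alpha\gamma P(z)\right\|_p\leq \left|n(n-\alpha-\gamma)+\alpha\gamma\right|\,\left\|P(z)\right\|_p.$$ The results are best possible, and equality holds in both inequalities for $P(z)=cz^n$, $c\neq 0$.
   Context: For a complex polynomial $f(z)$ and $0<p<\infty$, $\|f(z)\|_p:=\left(\frac{1}{2\pi}\int_0^{2\pi}|f(e^{i\theta})|^p\,d\theta\right)^{1/p}$. For $p=0$, $\|f(z)\|_0:=\exp\left(\frac{1}{2\pi}\int_0^{2\pi}\log|f(e^{i\theta})|\,d\theta\right)$ (the Mahler measure), which is read as $0$ when $f$ is the zero polynomial. *)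

(* Defs.v *)
From HB Require Import structures.
From mathcomp Require Import all_boot all_order all_algebra.
From mathcomp Require Import all_classical all_reals all_analysis.
From mathcomp Require Export complex.

Set Implicit Arguments.
Unset Strict Implicit.
Unset Printing Implicit Defensive.

Import Order.TTheory GRing.Theory Num.Theory.
Import numFieldNormedType.Exports.

Local Open Scope classical_set_scope.
Local Open Scope ring_scope.

(* In the library [`|z|] is again an element of [R[i]]; [normc z] is the same
   modulus as an element of [R]. *)
Notation cmod := ComplexField.Normc.normc.

Definition cis (R : realType) (t : R) : R[i] := (cos t +i* sin t)%C.

(* The mean over the unit circle is taken in the extended reals. For p = 0,
   [lne 0 = -oo] and [expeR -oo = 0], so that the zero polynomial gets the
   value 0. The second branch is meant for 0 < p. *)
Definition pnorm (R : realType) (p : R) (f : {poly R[i]}) : \bar R :=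
  (if p == 0%R then
     expeR (((2 * pi)^-1)%:E *
       \int[lebesgue_measure]_(t in `[0%R, (2 * pi)%R])
         lne (cmod f.[cis t])%:E)
   else
     (((2 * pi)^-1)%:E *
       \int[lebesgue_measure]_(t in `[0%R, (2 * pi)%R])
         ((cmod f.[cis t]) `^ p)%:E) `^ p^-1)%E.

Definition op1 (R : realType) (alpha : R[i]) (P : {poly R[i]}) : {poly R[i]} :=
  'X * P^`() - alpha *: P.

Definition op2 (R : realType) (alpha gamma : R[i]) (P : {poly R[i]}) :
    {poly R[i]} :=
  'X^2 * P^`(2) + (1 - alpha - gamma) *: ('X * P^`()) + (alpha * gamma) *: P.

(* Main.v *)
Require Import Defs.
From HB Require Import structures.
From mathcomp Require Import all_boot all_order all_algebra.
From mathcomp Require Import all_classical all_reals all_analysis.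
From mathcomp Require Import measurable_realfun ring lra.
Set Implicit Arguments.
Unset Strict Implicit.
Unset Printing Implicit Defensive.
Import Order.TTheory GRing.Theory Num.Theory.
Import numFieldNormedType.Exports.
Local Open Scope ring_scope.

(** Write T for the operator z d/dz - alpha. The second operator is the
    composite of the two operators of this kind with parameters alpha and gamma
    (op2E), and K2 = |n - alpha| |n - gamma|; since Re gamma <= n/2 < n, the
    inner one preserves the degree. So everything rests on the first inequality
    (pnorm_op1_le). Both operators multiply z^n by a scalar, whence equality for
    c z^n, and z^n itself shows that the constants are sharp.

    For p = 0 (logmean_op1_le), reflect into the closed unit disk all roots of Q
    that lie outside it, roots at infinity included, to get a polynomial Q* with
    |Q*| = |Q| on the circle. Then |T Q| <= |T Q*| on the circle
    (op1_reflect_le): each linear factor contributes a term to z Q'/Q, and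
    reflecting a root replaces this term by its mirror image in the line
    Re = 1/2; since Re alpha <= n/2, this can only move z Q'/Q away from alpha.
    By the argument of Gauss and Lucas T Q* has no zeros outside the closed disk
    either (op1_lprod_neq0). Jensen's formula then reads off the Mahler measures
    of Q* and T Q* from their leading coefficients, whose quotient is n - alpha.

    For p > 0 follow Arestov. By Jensen's formula ln^+ |a| is the mean over s of
    ln |a + e^(is)|. On the circle e^(is) may be replaced by e^(is) z^n, and
    T z^n = (n - alpha) z^n, so averaging the case p = 0 over the polynomials
    P + e^(is) z^n gives the inequality for the mean of ln^+ (lnp_op1_le).
    Applied to multiples of P it yields the one for p-th powers, because
    x^p = p^2 times the integral over s of ln^+ (x e^s) e^(- p s)
    (powR_integral).

    Jensen's formula itself comes from two symmetries of the circle. The mean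
    m(w) of ln |1 + w z| over |z| = 1 satisfies 2 m(w) = m(- w^2), because
    (1 + w z) (1 - w z) = 1 - w^2 z^2 and z -> - z, z -> z^2 preserve means; a
    bounded solution of this equation on |w| <= 1 vanishes. That m is bounded,
    even for |w| = 1, follows by running the same argument on logarithms
    truncated below. *)

(** * The modulus of complex numbers *)
Section Modulus.
Variable R : realType.
Implicit Types u v w z : R[i].

Lemma sqr_cmod z : cmod z ^+ 2 = complex.Re z ^+ 2 + complex.Im z ^+ 2.
Proof. by case: z => x y /=; rewrite sqr_sqrtr// addr_ge0 ?sqr_ge0. Qed.

Lemma cmod_ge0 z : 0 <= cmod z.
Proof. by case: z => x y /=; exact: sqrtr_ge0. Qed.

Lemma cmod0 : cmod (0 : R[i]) = 0.
Proof. exact: ComplexField.Normc.normc0. Qed.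

Lemma cmod1 : cmod (1 : R[i]) = 1.
Proof. exact: ComplexField.Normc.normc1. Qed.

Lemma cmodM u v : cmod (u * v) = cmod u * cmod v.
Proof. exact: ComplexField.Normc.normcM. Qed.

Lemma cmodN u : cmod (- u) = cmod u.
Proof. exact: normcN. Qed.

Lemma cmodD u v : cmod (u + v) <= cmod u + cmod v.
Proof. exact: le_normcD. Qed.

Lemma cmodV u : cmod u^-1 = (cmod u)^-1.
Proof. exact: ComplexField.Normc.normcV. Qed.

Lemma cmodX u n : cmod (u ^+ n) = cmod u ^+ n.
Proof. by elim: n => [|n ih]; rewrite ?expr0 ?cmod1// !exprS cmodM ih. Qed.

Lemma cmod_eq0 u : (cmod u == 0) = (u == 0).
Proof.
by apply/eqP/eqP => [/ComplexField.Normc.eq0_normc//|->]; exact: cmod0.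
Qed.

Lemma cmod_gt0 u : (0 < cmod u) = (u != 0).
Proof. by rewrite lt_neqAle cmod_ge0 andbT eq_sym cmod_eq0. Qed.

Lemma cmod_conj u : cmod (conjc u) = cmod u.
Proof. by case: u => x y /=; rewrite sqrrN. Qed.

Lemma cmod_real (x : R) : 0 <= x -> cmod (x%:C)%C = x.
Proof. by move=> x0 /=; rewrite expr0n addr0 sqrtr_sqr ger0_norm. Qed.

Lemma conjc_unit z : cmod z = 1 -> conjc z = z^-1.
Proof.
move=> z1; have z0 : z != 0 by rewrite -cmod_gt0 z1.
apply: (mulfI z0); rewrite divff//.
have := sqr_cmod z; rewrite z1 expr1n; case: z {z1 z0} => x y /= h.
by apply/eqP; rewrite eq_complex /=; apply/andP; split; apply/eqP; lra.
Qed.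

Lemma cmod_cis (t : R) : cmod (cis t) = 1.
Proof. by rewrite /cis /= cos2Dsin2 sqrtr1. Qed.

(** This is where the bound n / 2 comes from: a factor a z + b contributes
    a z / (a z + b) to z Q'/Q, and the side of the line Re = 1/2 on which this
    term lies depends on which of |a z| and |b| is larger. *)
Lemma Re_div_add u v : u + v != 0 ->
  (2 * complex.Re (u / (u + v)) - 1) * cmod (u + v) ^+ 2 =
    cmod u ^+ 2 - cmod v ^+ 2.
Proof.
move=> uv0.
have : cmod (u + v) ^+ 2 != 0 by rewrite expf_neq0// cmod_eq0.
rewrite !sqr_cmod; case: u uv0 => a b; case: v => c d uv0 /= h.
by field; exact: h.
Qed.

End Modulus.

(** * The operator z d/dz - alpha *)
Section Operator.
Variable R : realType.
Implicit Types (al : R[i]) (P Q : {poly R[i]}).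

Lemma op1D al P Q : op1 al (P + Q) = op1 al P + op1 al Q.
Proof. by rewrite /op1 derivD mulrDr scalerDr opprD addrACA. Qed.

Lemma op1Z al c P : op1 al (c *: P) = c *: op1 al P.
Proof. by rewrite /op1 derivZ -scalerAr scalerBr !scalerA (mulrC al). Qed.

Lemma op10 al : op1 al 0 = 0.
Proof. by rewrite /op1 deriv0 mulr0 scaler0 subr0. Qed.

Lemma op1Xn al n : op1 al 'X^n = (n%:R - al) *: 'X^n.
Proof.
rewrite /op1 derivXn scalerBl; congr (_ - _).
case: n => [|n]; first by rewrite mulr0n mulr0 scale0r.
by rewrite mulrnAr -exprS scaler_nat.
Qed.

Lemma coef_op1 al P i : (op1 al P)`_i = (i%:R - al) * P`_i.
Proof.
rewrite /op1 coefB coefZ coefXM coef_deriv mulrBl.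
by case: i => [|i] /=; rewrite ?mul0r ?mulr_natl.
Qed.

Lemma op2E al ga P : op2 al ga P = op1 al (op1 ga P).
Proof.
apply/polyP => i; rewrite !coef_op1 /op2 !coefD !coefZ coefXnM coefXM.
case: i => [|[|i]]; rewrite /= ?coef_derivn ?coef_deriv ?add1n ?subn0.
- ring.
- rewrite mulr1n; ring.
have e1 : i.+1%:R = i%:R + 1 :> R[i] by rewrite -addn1 natrD.
have e2 : i.+2%:R = i%:R + 2 :> R[i] by rewrite -addn2 natrD.
rewrite ?subn2 ?subSS ?subn0 /=.
rewrite -(mulr_natl (P`_i.+2 *+ i.+2) i.+1) -(mulr_natl P`_i.+2 i.+2) e1 e2.
ring.
Qed.

Lemma nat_sub_neq0 n al : (0 < n)%N -> complex.Re al <= n%:R / 2 ->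
  n%:R - al != 0.
Proof.
move=> n0 al_le; apply: contraTneq al_le => /eqP; rewrite subr_eq0 => /eqP <-.
rewrite (_ : complex.Re n%:R = n%:R); last first.
  by rewrite -(rmorph_nat (real_complex R)).
by rewrite -ltNge; move: n0; rewrite -(ltr_nat R); lra.
Qed.

Lemma size_op1 n al P : n%:R - al != 0 -> size P = n.+1 ->
  size (op1 al P) = n.+1.
Proof.
move=> nal sP; apply/eqP; rewrite eqn_leq; apply/andP; split.
  by apply/leq_sizeP => j nj; rewrite coef_op1 nth_default ?mulr0// sP.
rewrite ltnNge; apply/negP => h.
have /eqP := nth_default 0 h; rewrite coef_op1 mulf_eq0 (negbTE nal) /=.
apply/negP; rewrite -[n]/n.+1.-1 -sP -/(lead_coef P) lead_coef_eq0.
by rewrite -size_poly_gt0 sP.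
Qed.

Lemma op1_horner al P z :
  (op1 al P).[z] = z * P^`().[z] - al * P.[z].
Proof. by rewrite /op1 !hornerE. Qed.

End Operator.

(** * Linear factors and their reflection in the unit circle *)
Section Factors.
Variable R : realType.
Implicit Types (al : R[i]) (p : R[i] * R[i]) (l : seq (R[i] * R[i])).

Definition lfac p : {poly R[i]} := p.1 *: 'X + p.2%:P.

Definition lprod l : {poly R[i]} := \prod_(p <- l) lfac p.

(** The root - b / a, if outside the closed disk, is replaced by its mirror image
    - conj a / conj b with respect to the unit circle. *)
Definition reflect_fac p :=
  if cmod p.1 < cmod p.2 then (conjc p.2, conjc p.1) else p.

Lemma lfacE p z : (lfac p).[z] = p.1 * z + p.2.
Proof. by rewrite /lfac !hornerE. Qed.

Lemma lprod_cons p l : lprod (p :: l) = lfac p * lprod l.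
Proof. by rewrite /lprod big_cons. Qed.

Lemma deriv_lfac p : (lfac p)^`() = p.1%:P.
Proof. by rewrite /lfac derivD derivC derivZ derivX alg_polyC addr0. Qed.

(** By the Leibniz rule, peeling off a nonvanishing factor only shifts the
    parameter of the operator, which is what makes the two inductions below
    work. *)
Lemma op1_lfac al p Q z : (lfac p).[z] != 0 ->
  (op1 al (lfac p * Q)).[z] =
    (lfac p).[z] * (op1 (al - p.1 * z / (lfac p).[z]) Q).[z].
Proof.
move=> f0; rewrite !op1_horner derivM deriv_lfac !hornerM hornerD !hornerM hornerC.
by move: f0; rewrite !lfacE => f0; field.
Qed.

Lemma op1_lfac0 al p Q z : (lfac p).[z] = 0 ->
  (op1 al (lfac p * Q)).[z] = p.1 * z * Q.[z].
Proof.
move=> f0; rewrite op1_horner derivM deriv_lfac !hornerM hornerD !hornerM hornerC.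
by rewrite f0; ring.
Qed.

(** On the unit circle conj z = 1 / z. *)
Lemma lfac_reflect_unit p z : cmod z = 1 ->
  cmod p.1 < cmod p.2 ->
  (lfac (reflect_fac p)).[z] = z * conjc (lfac p).[z].
Proof.
move=> z1; rewrite /reflect_fac => ->; rewrite !lfacE /= rmorphD rmorphM /=.
rewrite (conjc_unit z1); field.
by rewrite -cmod_gt0 z1.
Qed.

Lemma cmod_lfac_reflect p z : cmod z = 1 ->
  cmod (lfac (reflect_fac p)).[z] = cmod (lfac p).[z].
Proof.
move=> z1; have [ab|ab] := ltP (cmod p.1) (cmod p.2).
  by rewrite lfac_reflect_unit// cmodM z1 mul1r cmod_conj.
by rewrite /reflect_fac ltNge ab.
Qed.

Lemma cmod_lprod_reflect l z : cmod z = 1 ->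
  cmod (lprod (map reflect_fac l)).[z] = cmod (lprod l).[z].
Proof.
move=> z1; elim: l => [|p l ih] //=.
by rewrite !lprod_cons !hornerM !cmodM ih cmod_lfac_reflect.
Qed.

Lemma reflect_fac_le p : cmod (reflect_fac p).2 <= cmod (reflect_fac p).1.
Proof.
rewrite /reflect_fac; case: ltP => //= /ltW; by rewrite !cmod_conj.
Qed.

Lemma reflect_fac_max p :
  cmod (reflect_fac p).1 = Num.max (cmod p.1) (cmod p.2).
Proof. by rewrite /reflect_fac; case: ltP => //=; rewrite cmod_conj. Qed.

(** Because conj z = 1 / z on the unit circle, a factor that is reflected has its
    term x replaced by conj (1 - x), the mirror image of x in the line
    Re = 1/2. *)
Lemma logderiv_reflect p z : cmod z = 1 -> (lfac p).[z] != 0 ->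
  let x := p.1 * z / (lfac p).[z] in
  let y := (reflect_fac p).1 * z / (lfac (reflect_fac p)).[z] in
  [/\ complex.Im x = complex.Im y, complex.Re x <= complex.Re y &
      1 <= complex.Re x + complex.Re y].
Proof.
move=> z1 f0 x y.
have N0 : 0 < cmod (lfac p).[z] ^+ 2 by rewrite exprn_gt0// cmod_gt0.
have := Re_div_add (u := p.1 * z) (v := p.2); rewrite -lfacE -/x.
move=> /(_ f0); rewrite cmodM z1 mulr1 => xE.
have z0 : z != 0 by rewrite -cmod_gt0 z1.
have [ab|ab] := ltP (cmod p.1) (cmod p.2).
  have yE : y = conjc (1 - x).
    rewrite /y lfac_reflect_unit// /reflect_fac ab/=.
    rewrite (_ : 1 - x = p.2 / (lfac p).[z]).
      by rewrite rmorphM /= conjc_inv; field; rewrite z0 conjc_eq0 f0.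
    by rewrite /x; move: f0; rewrite lfacE => f0; field.
  have xlt : 2 * complex.Re x - 1 < 0.
    rewrite -(pmulr_llt0 _ N0) xE subr_lt0 ltr_pXn2r// nnegrE cmod_ge0//.
  rewrite yE; case: x xlt {y yE xE} => a b /= xlt; split; lra.
have yx : y = x by rewrite /y /x /reflect_fac ltNge ab.
have xge : 0 <= 2 * complex.Re x - 1.
  by rewrite -(pmulr_lge0 _ N0) xE subr_ge0 lerXn2r// nnegrE cmod_ge0.
by rewrite yx; split => //; lra.
Qed.

(** Allowing two parameters makes an induction on the factors possible: each
    factor shifts them by the terms compared in logderiv_reflect, so that the
    imaginary parts stay equal, the order of the real parts is kept, and the sum
    of the real parts drops by at least 1. Without factors, Re al' is at most
    - |Re al|, and the images of the constant 1 compare as claimed. *)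
Lemma op1_reflect_le l z al al' : cmod z = 1 ->
  complex.Im al = complex.Im al' -> complex.Re al' <= complex.Re al ->
  complex.Re al + complex.Re al' <= (size l)%:R ->
  cmod (op1 al (lprod l)).[z] <= cmod (op1 al' (lprod (map reflect_fac l))).[z].
Proof.
move=> z1; elim: l al al' => [|p l ih] al al' im re sz.
  rewrite /lprod !big_nil !op1_horner -polyC1 !derivC !hornerC ?horner0 mulr0.
  rewrite !sub0r !mulr1 !cmodN -(@ler_pXn2r _ 2) ?nnegrE ?cmod_ge0//.
  by rewrite !sqr_cmod im lerD2r; move: sz => /=; nra.
have [f0|f0] := eqVneq (lfac p).[z] 0.
  (* A root on the circle is its own mirror image, and only the term with the
     derivative of its factor survives at z. *)
  have ab : cmod p.1 = cmod p.2.
    move: f0; rewrite lfacE => /eqP; rewrite addr_eq0 => /eqP h.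
    by rewrite -[LHS]mulr1 -z1 -cmodM h cmodN.
  have rp : reflect_fac p = p by rewrite /reflect_fac ab ltxx.
  rewrite map_cons rp !lprod_cons !op1_lfac0// !cmodM cmod_lprod_reflect//.
have g0 : (lfac (reflect_fac p)).[z] != 0.
  by rewrite -cmod_gt0 cmod_lfac_reflect// cmod_gt0.
rewrite map_cons !lprod_cons !op1_lfac// !cmodM cmod_lfac_reflect//.
rewrite ler_wpM2l ?cmod_ge0//.
have /= [im1 re1 sum1] := logderiv_reflect z1 f0.
move: im1 re1 sum1; set x := p.1 * z / _; set y := _ / _ => im1 re1 sum1.
apply: ih; move: im re sz im1 re1 sum1; rewrite /= -natr1;
  case: al => ? ?; case: al' => ? ?; case: x => ? ?; case: y => ? ? /=; lra.
Qed.

(** The argument of Gauss and Lucas: if all roots lie in the closed unit disk, then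
    outside it every term of z Q'/Q has real part greater than 1/2. *)
Lemma op1_lprod_neq0 l z al : 1 < cmod z ->
  (forall p, p \in l -> p.1 != 0 /\ cmod p.2 <= cmod p.1) -> (0 < size l)%N ->
  complex.Re al <= (size l)%:R / 2 -> (op1 al (lprod l)).[z] != 0.
Proof.
move=> z1.
have step p : p.1 != 0 -> cmod p.2 <= cmod p.1 ->
    (lfac p).[z] != 0 /\ 1 / 2 < complex.Re (p.1 * z / (lfac p).[z]).
  move=> a0 ba.
  have lt : cmod p.2 < cmod (p.1 * z).
    by rewrite cmodM (le_lt_trans ba)// ltr_pMr// cmod_gt0.
  have f0 : (lfac p).[z] != 0.
    rewrite lfacE addr_eq0; apply: contraTneq lt => ->.
    by rewrite cmodN ltxx.
  split=> //.
  have N0 : 0 < cmod (lfac p).[z] ^+ 2 by rewrite exprn_gt0// cmod_gt0.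
  have := Re_div_add (u := p.1 * z) (v := p.2); rewrite -lfacE.
  move=> /(_ f0) E.
  have : 0 < 2 * complex.Re (p.1 * z / (lfac p).[z]) - 1.
    by rewrite -(pmulr_lgt0 _ N0) E subr_gt0 ltr_pXn2r// nnegrE cmod_ge0.
  lra.
(* With a strict inequality the claim also holds for no factors; the first
   factor makes the inequality strict. *)
have strict m be : (forall p, p \in m -> p.1 != 0 /\ cmod p.2 <= cmod p.1) ->
    complex.Re be < (size m)%:R / 2 -> (op1 be (lprod m)).[z] != 0.
  elim: m be => [|p m ih] be mP sz.
    rewrite /lprod big_nil op1_horner -polyC1 derivC !hornerC ?horner0.
    rewrite mulr0 sub0r mulr1.
    rewrite oppr_eq0; apply: contraTneq sz => -> /=.
    by rewrite mul0r ltxx.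
  have /mP[a0 ba] : p \in p :: m by rewrite mem_head.
  have [f0 re] := step _ a0 ba.
  rewrite lprod_cons op1_lfac// mulf_neq0//; apply: ih => [q qm|].
    by apply: mP; rewrite inE qm orbT.
  move: re sz; rewrite /= -natr1; set x := p.1 * z / _.
  by case: be => ? ?; case: x => ? ? /=; lra.
case: l => [//|p l] lP _ sz.
have /lP[a0 ba] : p \in p :: l by rewrite mem_head.
have [f0 re] := step _ a0 ba.
rewrite lprod_cons op1_lfac// mulf_neq0//; apply: strict => [q qm|].
  by apply: lP; rewrite inE qm orbT.
move: re sz; rewrite /= -natr1; set x := p.1 * z / _.
by case: al => ? ?; case: x => ? ? /=; lra.
Qed.

Lemma coef_lprod l :
  (size (lprod l) <= (size l).+1)%N /\ (lprod l)`_(size l) = \prod_(p <- l) p.1.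
Proof.
elim: l => [|p l [ih1 ih2]]; first by rewrite /lprod !big_nil size_poly1 coef1.
rewrite lprod_cons /lfac big_cons /=; split.
  rewrite mulrDl -scalerAl mul_polyC.
  rewrite (leq_trans (size_polyD _ _))// geq_max.
  rewrite (leq_trans (size_scale_leq _ _)) ?(leq_trans (size_scale_leq _ _))//.
    exact: leqW.
  by rewrite mulrC (leq_trans (size_polyMleq _ _))// size_polyX addn2.
rewrite mulrDl -scalerAl mul_polyC coefD !coefZ coefXM /= ih2.
by rewrite (nth_default 0 ih1) mulr0 addr0.
Qed.

(** A factor whose first entry vanishes stands for a root at infinity. Padding
    with such factors treats all polynomials of degree at most n alike. *)
Lemma poly_lprod n (Q : {poly R[i]}) : (size Q <= n.+1)%N -> Q != 0 ->
  exists c l, [/\ Q = c *: lprod l, c != 0, size l = n &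
    forall p, p \in l -> p != (0, 0)].
Proof.
move=> sQ Q0; have [rs Qrs] := closed_field_poly_normal Q.
have c0 : lead_coef Q != 0 by rewrite lead_coef_eq0.
have srs : (size rs <= n)%N.
  by rewrite -ltnS -(size_prod_XsubC rs id) -(size_scale _ c0) -Qrs.
exists (lead_coef Q), ([seq (1, - r) | r <- rs] ++ nseq (n - size rs) (0, 1)).
split=> //.
- rewrite {1}Qrs; congr (_ *: _).
  rewrite /lprod big_cat big_map /= big_nseq.
  rewrite (_ : lfac (0, 1) = 1) ?/lfac /= ?scale0r ?add0r//.
  rewrite -Monoid.iteropE -/(1 ^+ _) expr1n mulr1.
  by apply: eq_bigr => r _; rewrite /= scale1r polyCN.
- by rewrite size_cat size_map size_nseq subnKC.
- move=> p; rewrite mem_cat => /orP[/mapP[r _ ->]|].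
    by rewrite xpair_eqE oner_eq0.
  by rewrite mem_nseq => /andP[_ /eqP ->]; rewrite xpair_eqE oner_eq0 andbF.
Qed.

End Factors.

(** * Affine substitutions in integrals *)
Section AffineSubstitution.
Local Open Scope classical_set_scope.
Variable R : realType.
Local Notation mu := (@lebesgue_measure R).
Implicit Types (f : R -> \bar R) (a b c u v : R).

Lemma measurable_affine a b :
  measurable_fun [set: R] (fun x : R => a * x + b).
Proof.
by apply: measurable_funD => //; apply: measurable_funM.
Qed.

Lemma affine_preimage_itv a b u v (lu lv : bool) : 0 < a ->
  (fun x : R => a * x + b) @^-1`
    [set` Interval (BSide lu (a * u + b)) (BSide lv (a * v + b))] =
  [set` Interval (BSide lu u) (BSide lv v)].
Proof.
move=> a0; apply/seteqP; split => x /=; case: lu; case: lv;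
  by rewrite !in_itv /= ?lerD2r ?ltrD2r !(ler_pM2l a0, ltr_pM2l a0).
Qed.

Lemma measurable_affine_borel a b :
  @measurable_fun _ _ (measurableTypeR R) (measurableTypeR R) setT
    (fun x => a * x + b).
Proof. exact: measurable_affine. Qed.

Definition affine_image a b : {measure set (measurableTypeR R) -> \bar R} :=
  measure_function_pushforward__canonical__measure_function_Measure
    mu (measurable_affine_borel a b).

(** Lebesgue measure is determined by its values on half-open intervals. *)
Lemma lebesgue_measure_affine a b (a0 : 0 < a) (A : set R) : measurable A ->
  mu A = mscale (NngNum (ltW a0)) (affine_image a b) A.
Proof.
apply: lebesgue_measure_unique => //= _ [[u v]] _ <-.
rewrite /mscale /affine_image /= /pushforward /=.
have uE : u = a * ((u - b) / a) + b by field; rewrite gt_eqF.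
have vE : v = a * ((v - b) / a) + b by field; rewrite gt_eqF.
rewrite [in RHS]uE [in RHS]vE affine_preimage_itv// !lebesgue_measure_itv/=.
rewrite !lte_fin ltr_pM2r ?invr_gt0// ltrD2r.
case: ifPn => _; last by rewrite mule0.
by rewrite -!EFinB -EFinM; congr EFin; field; rewrite gt_eqF.
Qed.

Lemma ge0_integral_affine f a b u v : 0 < a -> measurable_fun [set: R] f ->
  (forall x, 0 <= f x)%E ->
  (a%:E * \int[mu]_(x in `[u, v]) f (a * x + b)%R =
   \int[mu]_(x in `[(a * u + b)%R, (a * v + b)%R]) f x)%E.
Proof.
move=> a0 mf f0; set D := `[(a * u + b)%R, _].
rewrite [RHS](eq_measure_integral
  (mscale (NngNum (ltW a0)) (affine_image a b))); last first.
  by move=> A mA _; exact: lebesgue_measure_affine.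
rewrite ge0_integral_mscale//=; last exact: measurable_funTS.
congr (_ * _)%E.
rewrite /affine_image (ge0_integral_pushforward (measurable_affine_borel a b))//.
  by rewrite /D -/([set` _]) affine_preimage_itv.
- exact: measurable_itv.
- exact: measurable_funTS.
- exact: measurable_itv.
Qed.

Lemma ge0_integral_itv_split f a b c : a <= b -> b <= c ->
  measurable_fun [set: R] f -> (forall x, 0 <= f x)%E ->
  (\int[mu]_(x in `[a, c]) f x =
   \int[mu]_(x in `[a, b]) f x + \int[mu]_(x in `[b, c]) f x)%E.
Proof.
move=> ab bc mf f0.
rewrite -(integral_itv_obnd_cbnd (r := b)); last exact: measurable_funTS.
rewrite -ge0_integral_setU//.
- congr (integral _ _ _).
  by rewrite -itv_bndbnd_setU// bnd_simp.
- exact: measurable_funTS.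
- rewrite disj_set2E; apply/eqP/seteqP; split => x //= [].
  rewrite !in_itv/= => /andP[_ xb] /andP[bx _].
  by move: (lt_le_trans bx xb); rewrite ltxx.
Qed.

End AffineSubstitution.

(** * Two symmetries of the circle *)
Section Circle.
Local Open Scope classical_set_scope.
Variable R : realType.
Local Notation mu := (@lebesgue_measure R).
Implicit Types (F : R[i] -> \bar R).

Lemma cisDpi (t : R) : cis (t + pi) = - cis t.
Proof. by rewrite /cis cosDpi sinDpi. Qed.

Lemma cis2pi (t : R) : cis (t + 2 * pi) = cis t.
Proof. by rewrite mulrDl mul1r addrA !cisDpi opprK. Qed.

Lemma cis_sqr (t : R) : cis (2 * t) = cis t ^+ 2.
Proof.
rewrite /cis mulrDl mul1r cosD sinD expr2; apply/eqP.
by rewrite eq_complex /= eqxx /= addrC mulrC.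
Qed.

Let pi0 : (0 : R) <= pi := pi_ge0 R.

(** z -> - z exchanges the upper and the lower half of the circle. *)
Lemma circle_opp F : measurable_fun [set: R] (F \o @cis R) ->
  (forall t, 0 <= F (cis t))%E ->
  (\int[mu]_(t in `[0%R, (2 * pi)%R]) F (- cis t)%R =
   \int[mu]_(t in `[0%R, (2 * pi)%R]) F (cis t))%E.
Proof.
move=> mF F0.
have mF' : measurable_fun [set: R] (fun t => F (- cis t)%R).
  rewrite (_ : (fun t => _) = (F \o @cis R) \o (fun t => 1 * t + pi)).
    apply: measurableT_comp => //; exact: measurable_affine.
  by apply/funext => t /=; rewrite mul1r cisDpi.
have F0' t : (0 <= F (- cis t)%R)%E by rewrite -cisDpi.
have pi2 : pi <= 2 * pi :> R by have := pi0; lra.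
rewrite (ge0_integral_itv_split (b := pi))//.
rewrite [RHS](ge0_integral_itv_split (b := pi))// addeC; congr (_ + _)%E.
- have := ge0_integral_affine (f := F \o @cis R) (-pi) pi (2 * pi) ltr01 mF.
  move=> /(_ (fun t => F0 _)); rewrite mul1e !mul1r subrr.
  rewrite (_ : 2 * pi - pi = pi :> R); last by ring.
  move=> <-; apply: eq_integral => t _ /=.
  by rewrite mul1r -[t in LHS](subrK pi) cisDpi opprK.
- have := ge0_integral_affine (f := F \o @cis R) pi 0 pi ltr01 mF.
  move=> /(_ (fun t => F0 _)); rewrite mul1e mulr0 add0r mul1r.
  rewrite (_ : pi + pi = 2 * pi :> R); last by ring.
  move=> <-; apply: eq_integral => t _ /=.
  by rewrite mul1r cisDpi.
Qed.

(** z -> z^2 winds each half of the circle once around, at double speed. *)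
Lemma circle_sqr F : measurable_fun [set: R] (F \o @cis R) ->
  (forall t, 0 <= F (cis t))%E ->
  (\int[mu]_(t in `[0%R, (2 * pi)%R]) F (cis t ^+ 2)%R =
   \int[mu]_(t in `[0%R, (2 * pi)%R]) F (cis t))%E.
Proof.
move=> mF F0.
have mF' : measurable_fun [set: R] (fun t => F (cis t ^+ 2)%R).
  rewrite (_ : (fun t => _) = (F \o @cis R) \o (fun t => 2 * t + 0)).
    apply: measurableT_comp => //; exact: measurable_affine.
  by apply/funext => t /=; rewrite addr0 cis_sqr.
have F0' t : (0 <= F (cis t ^+ 2)%R)%E by rewrite -cis_sqr.
have pi2 : pi <= 2 * pi :> R by have := pi0; lra.
rewrite (ge0_integral_itv_split (b := pi))//.
have two0 : (0 : R) < 2 by [].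
have := ge0_integral_affine (f := F \o @cis R) 0 0 pi two0 mF.
move=> /(_ (fun t => F0 _)); rewrite mulr0 !addr0.
under eq_integral do rewrite /= addr0 cis_sqr.
move=> H1.
have := ge0_integral_affine (f := F \o @cis R) (- (2 * pi)) pi (2 * pi) two0 mF.
move=> /(_ (fun t => F0 _)); rewrite subrr.
rewrite (_ : 2 * (2 * pi) - 2 * pi = 2 * pi :> R); last by ring.
under eq_integral => t _.
  rewrite /= -(cis2pi (_ - _)) subrK cis_sqr; over.
move=> H2.
have h x : (2^-1%:E * (2%:E * x) = x :> \bar R)%E.
  by rewrite muleA -EFinM mulVf// mul1e.
set X := (\int[mu]_(x in `[0%R, pi]) _)%E in H1 *.
set Y := (\int[mu]_(x in `[pi, _]) _)%E in H2 *.
rewrite -(h X) -(h Y) H1 H2.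
set Z := integral _ _ _.
by rewrite -ge0_muleDl// -EFinD (_ : 2^-1 + 2^-1 = 1 :> R) ?mul1e//; field.
Qed.

End Circle.

(** * Measurability of complex-valued functions *)
Section ComplexMeasurability.
Local Open Scope classical_set_scope.
Context d (T : measurableType d) (R : realType).
Implicit Types f g : T -> R[i].

Definition cmeasurable f := measurable_fun [set: T] (fun x => complex.Re (f x)) /\
  measurable_fun [set: T] (fun x => complex.Im (f x)).

Lemma cmeasurable_cst c : cmeasurable (fun=> c).
Proof. by split; exact: measurable_cst. Qed.

Lemma cmeasurableD f g : cmeasurable f -> cmeasurable g ->
  cmeasurable (fun x => f x + g x).
Proof.
move=> [fr fi] [gr gi]; split.
  rewrite (_ : (fun _ => _) =
    (fun x => complex.Re (f x)) \+ (fun x => complex.Re (g x))).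
    exact: measurable_funD.
  by apply/funext => x /=; case: (f x) => ? ?; case: (g x).
rewrite (_ : (fun _ => _) =
  (fun x => complex.Im (f x)) \+ (fun x => complex.Im (g x))).
  exact: measurable_funD.
by apply/funext => x /=; case: (f x) => ? ?; case: (g x).
Qed.

Lemma cmeasurableM f g : cmeasurable f -> cmeasurable g ->
  cmeasurable (fun x => f x * g x).
Proof.
move=> [fr fi] [gr gi]; split.
  rewrite (_ : (fun _ => _) =
    (fun x => complex.Re (f x) * complex.Re (g x)) \-
    (fun x => complex.Im (f x) * complex.Im (g x))).
    by apply: measurable_funB; exact: measurable_funM.
  by apply/funext => x /=; case: (f x) => ? ?; case: (g x).
rewrite (_ : (fun _ => _) =
  (fun x => complex.Re (f x) * complex.Im (g x)) \+
  (fun x => complex.Im (f x) * complex.Re (g x))).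
  by apply: measurable_funD; exact: measurable_funM.
by apply/funext => x /=; case: (f x) => ? ?; case: (g x).
Qed.

Lemma cmeasurableX f n : cmeasurable f -> cmeasurable (fun x => f x ^+ n).
Proof.
move=> mf; elim: n => [|n ih]; first exact: cmeasurable_cst.
rewrite (_ : (fun _ => _) = (fun x => f x * f x ^+ n)).
  exact: cmeasurableM.
by apply/funext => x; rewrite exprS.
Qed.

Lemma cmeasurable_cis (u : T -> R) : measurable_fun [set: T] u ->
  cmeasurable (fun x => cis (u x)).
Proof.
move=> mu; split => /=; apply: (measurableT_comp _ mu);
  apply: continuous_measurable_fun; [exact: continuous_cos|exact: continuous_sin].
Qed.

Lemma cmeasurable_horner (P : {poly R[i]}) f : cmeasurable f ->
  cmeasurable (fun x => P.[f x]).
Proof.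
move=> mf; elim/poly_ind: P => [|P c ih].
  rewrite (_ : (fun _ => _) = (fun=> 0)); first exact: cmeasurable_cst.
  by apply/funext => x; rewrite horner0.
rewrite (_ : (fun _ => _) = (fun x => P.[f x] * f x + c)).
  by apply: cmeasurableD; [exact: cmeasurableM|exact: cmeasurable_cst].
by apply/funext => x; rewrite !hornerE.
Qed.

Lemma measurable_cmod f : cmeasurable f ->
  measurable_fun [set: T] (fun x => cmod (f x)).
Proof.
move=> [mr mi]; rewrite (_ : (fun _ => _) = Num.sqrt \o
    (fun x => complex.Re (f x) ^+ 2 + complex.Im (f x) ^+ 2)).
  apply: measurableT_comp.
    by apply: continuous_measurable_fun; exact: sqrt_continuous.
  by apply: measurable_funD; exact: measurable_funX.
by apply/funext => x /=; case: (f x).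
Qed.

Lemma measurable_lne (g : T -> R) : measurable_fun [set: T] g ->
  measurable_fun [set: T] (fun x => lne (g x)%:E).
Proof.
move=> mg; apply: measurable_fun_ifT => //=.
  exact: measurable_fun_ler.
by apply/measurable_EFinP; exact: measurableT_comp.
Qed.

End ComplexMeasurability.

(** * The extended logarithm *)
Section Lne.
Local Open Scope classical_set_scope.
Variable R : realType.
Implicit Types x y c : R.

Lemma lneMr x y : 0 <= x -> 0 <= y ->
  (lne (x * y)%:E = lne x%:E + lne y%:E)%E.
Proof.
rewrite le_eqVlt => /orP[/eqP <- y0|x0]; first by rewrite mul0r /= lexx.
rewrite le_eqVlt => /orP[/eqP <-|y0].
  by rewrite mulr0 /= lexx; case: ifP.
by rewrite !lne_EFin// ?mulr_gt0// lnM.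
Qed.

Lemma lne_le x y : x <= y -> (lne x%:E <= lne y%:E)%E.
Proof.
move=> xy /=; case: ifPn => // x0; first exact: leNye.
have {}x0 : 0 < x by rewrite ltNge.
have y0 := lt_le_trans x0 xy.
by rewrite (leNgt y) y0 /= lee_fin ler_ln.
Qed.

Lemma lne_le_ln x c : 0 < c -> x <= c -> (lne x%:E <= (ln c)%:E)%E.
Proof. by move=> c0 xc; rewrite -lne_EFin//; exact: lne_le. Qed.

Lemma subr_lne_ge0 x c : x <= expR c -> (0 <= c%:E - lne x%:E)%E.
Proof.
move=> xc; rewrite subre_ge0//.
by rewrite (le_trans (lne_le_ln (expR_gt0 c) xc))// expRK.
Qed.

End Lne.

(** * Jensen's formula for 1 + w z *)
Section Jensen.
Local Open Scope classical_set_scope.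
(** Along the orbits of s the excess of x over c at least doubles, so that a
    bounded x has none. *)
Lemma doubling_excess_le0 (R : realType) (T : Type) (P : T -> Prop) (s : T -> T)
    (x : T -> R) (c B : R) :
  (forall w, P w -> P (s w)) -> (forall w, P w -> x w <= B) ->
  (forall w, P w -> 2 * x w <= x (s w) + c) -> forall w, P w -> x w <= c.
Proof.
move=> Ps xB x2 w Pw; pose S := [set x v | v in P].
have hS : has_sup S by split; [exists (x w), w|exists B => _ [v /xB ? <-]].
have xS v : P v -> x v <= sup S.
  by move=> Pv; apply: ub_le_sup; [exact: hS.2|exists v].
have : sup S <= (sup S + c) / 2.
  apply: ge_sup; first exact: hS.1.
  by move=> _ [v Pv <-]; have := x2 _ Pv; have := xS _ (Ps _ Pv); lra.
by have := xS _ Pw; lra.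
Qed.

Variable R : realType.
Local Notation mu := (@lebesgue_measure R).
Local Notation circle := `[0%R, (2 * pi)%R].
Implicit Types (w z : R[i]) (e x y t : R) (k : nat).

Let pi0 : (0 : R) < pi := pi_gt0 R.

Lemma circle_measure : (mu circle = (2 * pi)%:E)%E.
Proof.
rewrite lebesgue_measure_itv /= lte_fin mulr_gt0// -EFinB subr0 //.
Qed.

Lemma circle_cst (r : R) : (\int[mu]_(t in circle) r%:E = (2 * pi * r)%:E)%E.
Proof.
rewrite integral_cst; last exact: measurable_itv.
transitivity (r%:E * (2 * pi)%:E)%E; last by rewrite -EFinM mulrC.
by congr (_ * _)%E; exact: circle_measure.
Qed.

Lemma integrable_cst_circle (r : R) :
  mu.-integrable circle (fun=> r%:E).
Proof.
have fin : (mu circle < +oo)%E by rewrite circle_measure ltry.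
apply: (measurable_bounded_integrable _ fin) => //.
by exists `|r|; split => // M rM t _ /=; exact: ltW.
Qed.

Lemma le_cmod_add1 w t : cmod w <= 1 -> cmod (1 + w * cis t) <= 2.
Proof.
move=> w1; rewrite (le_trans (cmodD _ _))// cmod1 cmodM cmod_cis mulr1.
by lra.
Qed.

Lemma cmeasurable_add1 w : cmeasurable (fun t => 1 + w * cis t).
Proof.
apply: cmeasurableD; first exact: cmeasurable_cst.
by apply: cmeasurableM; [exact: cmeasurable_cst|exact: cmeasurable_cis].
Qed.

(** The logarithm truncated below at - k: its means are finite for trivial
    reasons. *)
Definition lnt k x : R := ln (Num.max x (expR (- k%:R))).

Lemma lnt_ge k x : - k%:R <= lnt k x.
Proof.
rewrite -[leLHS]expRK ler_ln ?posrE ?expR_gt0//; first by rewrite le_max lexx orbT.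
by rewrite lt_max expR_gt0 orbT.
Qed.

Lemma lnt_le2 k x : x <= 2 -> lnt k x <= ln 2.
Proof.
move=> x2; rewrite ler_ln ?posrE ?lt_max ?expR_gt0 ?orbT// ge_max x2 /=.
by rewrite (le_trans _ (_ : 1 <= 2))// ?ler1n.
Qed.

(** The larger of x and y is at least 1, so its truncated logarithm is nonnegative
    and may be dropped; the smaller one is at least half the product. *)
Lemma lnt_mul k x y : 0 <= x <= 2 -> 0 <= y <= 2 -> 1 <= Num.max x y ->
  lnt k (x * y) - ln 2 <= lnt k x + lnt k y.
Proof.
wlog xy : x y / y <= x.
  move=> h x2 y2 xy; have [yx|/ltW yx] := leP y x; first exact: h.
  by rewrite mulrC [X in _ <= X]addrC; apply: h => //; rewrite maxC.
move=> /andP[x0 x2] /andP[y0 y2]; rewrite (max_idPl xy) => x1.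
have l0 : 0 <= lnt k x by rewrite ln_ge0// le_max x1.
suff : lnt k (x * y) <= ln 2 + lnt k y by lra.
have m0 : 0 < Num.max y (expR (- k%:R)) by rewrite lt_max expR_gt0 orbT.
rewrite -lnM ?posrE// ler_ln ?posrE ?mulr_gt0// ?lt_max ?expR_gt0 ?orbT//.
rewrite ge_max; apply/andP; split.
  rewrite (@le_trans _ _ (2 * y))// ?ler_wpM2r// ler_wpM2l//.
  by rewrite le_max lexx.
have e0 := expR_gt0 (- k%:R : R).
rewrite (@le_trans _ _ (2 * expR (- k%:R)))//; first by lra.
by rewrite ler_wpM2l// le_max lexx orbT.
Qed.

(** The two numbers add up to 2. *)
Lemma max_add1 w z : 1 <= Num.max (cmod (1 + w * z)) (cmod (1 + w * - z)).
Proof.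
have gen (a b : R) : 2 <= a + b -> 1 <= Num.max a b.
  by move=> ab; rewrite le_max; have [//|a1] := leP 1 a; rewrite /=; lra.
apply: gen; apply: le_trans (cmodD _ _).
rewrite mulrN addrACA subrr addr0.
have -> : 1 + 1 = (2%:C)%C :> R[i].
  by apply/eqP; rewrite eq_complex /= addr0 !eqxx.
by rewrite cmod_real.
Qed.

Lemma mul_add1 w z : (1 + w * z) * (1 + w * - z) = 1 + (- w ^+ 2) * z ^+ 2.
Proof. by ring. Qed.

Definition mean_add1 (L : R -> \bar R) w : \bar R :=
  (\int[mu]_(t in circle) L (cmod (1 + w * cis t))%R)%E.

Lemma measurable_add1 (L : R -> \bar R) w : measurable_fun [set: R] L ->
  measurable_fun [set: R] (fun t => L (cmod (1 + w * cis t))%R).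
Proof.
move=> mL; apply: (measurableT_comp mL); apply: measurable_cmod.
exact: cmeasurable_add1.
Qed.

Lemma cmodNsqr_le1 w : cmod w <= 1 -> cmod (- w ^+ 2) <= 1.
Proof. by move=> w1; rewrite cmodN cmodX exprn_ile1// cmod_ge0. Qed.

(** By the symmetry z -> - z, the mean over 1 + w z is also one over 1 - w z. *)
Lemma mean_add1_double (L : R -> \bar R) w : measurable_fun [set: R] L ->
  (forall x, (x <= 2)%R -> 0 <= L x)%E -> cmod w <= 1 ->
  (mean_add1 L w + mean_add1 L w = \int[mu]_(t in circle)
    (L (cmod (1 + w * cis t))%R + L (cmod (1 + w * - cis t))%R))%E.
Proof.
move=> mL L0 w1; have mLw := measurable_add1 w mL.
have Lw0 t : (0 <= L (cmod (1 + w * cis t))%R)%E by rewrite L0// le_cmod_add1.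
have mLN : measurable_fun circle (fun t => L (cmod (1 + w * - cis t))%R).
  apply: measurable_funTS; rewrite (_ : (fun t => _) =
      (fun t => L (cmod (1 + w * cis t))) \o (fun t => 1 * t + pi)).
    by apply: measurableT_comp => //; exact: measurable_affine.
  by apply/funext => t /=; rewrite mul1r cisDpi.
rewrite {2}/mean_add1 -(circle_opp (F := fun z => L (cmod (1 + w * z))%R))//.
rewrite -ge0_integralD//; first exact: measurable_funTS.
by move=> t _; rewrite -cisDpi.
Qed.

(** By the symmetry z -> z^2 and (1 + w z) (1 - w z) = 1 - w^2 z^2. *)
Lemma mean_add1_sqr (L : R -> \bar R) w : measurable_fun [set: R] L ->
  (forall x, (x <= 2)%R -> 0 <= L x)%E -> cmod w <= 1 ->
  (mean_add1 L (- w ^+ 2)%R = \int[mu]_(t in circle)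
    L (cmod (1 + w * cis t) * cmod (1 + w * - cis t))%R)%E.
Proof.
move=> mL L0 w1; have mLw := measurable_add1 (- w ^+ 2) mL.
have Lw0 t : (0 <= L (cmod (1 + (- w ^+ 2) * cis t))%R)%E.
  by rewrite L0// le_cmod_add1// cmodNsqr_le1.
rewrite /mean_add1 -(circle_sqr (F := fun z => L (cmod (1 + (- w ^+ 2) * z))))//.
by apply: eq_integral => t _; rewrite -cmodM mul_add1.
Qed.

Let trunc k x : \bar R := (ln 2 - lnt k x)%:E.

Let measurable_trunc k : measurable_fun [set: R] (trunc k).
Proof.
apply/measurable_EFinP; apply: measurable_funB => //.
by apply: (measurableT_comp (@measurable_ln R)); exact: measurable_maxr.
Qed.

Let trunc_ge0 k x : x <= 2 -> (0 <= trunc k x)%E.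
Proof. by move=> x2; rewrite lee_fin subr_ge0 lnt_le2. Qed.

Let ln2_ge0 : 0 <= ln 2 :> R. Proof. by rewrite ln_ge0// ler1n. Qed.

Let trunc_double k w : cmod w <= 1 ->
  (mean_add1 (trunc k) w + mean_add1 (trunc k) w <=
   mean_add1 (trunc k) (- w ^+ 2)%R + (4 * pi * ln 2)%:E)%E.
Proof.
move=> w1; rewrite mean_add1_double ?mean_add1_sqr//; try exact: trunc_ge0.
rewrite (_ : 4 * pi * ln 2 = 2 * pi * (2 * ln 2)); last by ring.
have cmod2 t : cmod (1 + w * - cis t) <= 2 by rewrite -cisDpi le_cmod_add1.
have mN : measurable_fun [set: R] (fun t => cmod (1 + w * - cis t)).
  apply: measurable_cmod; apply: cmeasurableD; first exact: cmeasurable_cst.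
  apply: cmeasurableM; first exact: cmeasurable_cst.
  rewrite (_ : (fun t => _) = (fun t => cis (1 * t + pi))).
    by apply: cmeasurable_cis; exact: measurable_affine.
  by apply/funext => t; rewrite mul1r cisDpi.
have mP : measurable_fun [set: R] (fun t => cmod (1 + w * cis t)).
  by apply: measurable_cmod; exact: cmeasurable_add1.
have prod2 t : cmod (1 + w * cis t) * cmod (1 + w * - cis t) <= 2.
  by rewrite -cmodM mul_add1 -cis_sqr le_cmod_add1// cmodNsqr_le1.
have mtr (u : R -> R) : measurable_fun [set: R] u ->
    measurable_fun circle (fun t => trunc k (u t)).
  move=> mu_; apply: measurable_funTS.
  exact: (measurableT_comp (@measurable_trunc k)).
rewrite -circle_cst -ge0_integralD//=; last 3 first.
- by move=> t _; exact: trunc_ge0.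
- by apply: mtr; exact: measurable_funM.
- by move=> t _; rewrite lee_fin mulr_ge0.
apply: ge0_le_integral => //.
- by move=> t _; rewrite adde_ge0// trunc_ge0// le_cmod_add1.
- by apply: emeasurable_funD; exact: mtr.
- by apply: emeasurable_funD => //; apply: mtr; exact: measurable_funM.
move=> t _; rewrite /trunc -!EFinD lee_fin.
have := @lnt_mul k (cmod (1 + w * cis t)) (cmod (1 + w * - cis t)).
rewrite !cmod_ge0 le_cmod_add1// cmod2 => /(_ isT isT (max_add1 _ _)); lra.
Qed.

(** The bound does not depend on k: this is the integrability of the logarithm
    near a zero on the circle. *)
Let trunc_le k w : cmod w <= 1 ->
  (0 <= mean_add1 (trunc k) w)%E /\
  (mean_add1 (trunc k) w <= (4 * pi * ln 2)%:E)%E.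
Proof.
have bnd v : cmod v <= 1 -> (0 <= mean_add1 (trunc k) v)%E /\
    (mean_add1 (trunc k) v <= (2 * pi * (ln 2 + k%:R))%:E)%E.
  move=> v1; split.
    by apply: integral_ge0 => t _; rewrite trunc_ge0// le_cmod_add1.
  rewrite -circle_cst; apply: ge0_le_integral => //.
  - by move=> t _; rewrite trunc_ge0// le_cmod_add1.
  - by apply: measurable_funTS; exact: measurable_add1.
  - by move=> t _; rewrite lee_fin lerD2l lerNl lnt_ge.
have fin v : cmod v <= 1 -> mean_add1 (trunc k) v \is a fin_num.
  by move=> /bnd[v0 v1]; rewrite ge0_fin_numE// (le_lt_trans v1)// ltry.
move=> w1; split; first exact: (bnd _ w1).1.
rewrite -(fineK (fin _ w1)) lee_fin.
apply: (@doubling_excess_le0 _ _ (fun v => cmod v <= 1) (fun v => - v ^+ 2)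
  (fine \o mean_add1 (trunc k)) _ (2 * pi * (ln 2 + k%:R)) cmodNsqr_le1) w1
  => v v1 /=.
  by rewrite -lee_fin (fineK (fin _ v1)); exact: (bnd _ v1).2.
rewrite -lee_fin mulrDl mul1r !EFinD !fineK ?fin ?cmodNsqr_le1//.
exact: trunc_double.
Qed.

(** Subtracting from ln 2 makes the integrand nonnegative, since |1 + w z| <= 2;
    the value at x = 0 is +oo. *)
Definition log_defect x : \bar R := ((ln 2)%:E - lne x%:E)%E.

Lemma measurable_log_defect : measurable_fun [set: R] log_defect.
Proof. by apply: emeasurable_funB => //; exact: measurable_lne. Qed.

Lemma log_defect_ge0 x : x <= 2 -> (0 <= log_defect x)%E.
Proof. by move=> x2; apply: subr_lne_ge0; rewrite lnK ?posrE. Qed.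

Lemma cvg_lnt x : 0 <= x ->
  (fun k => (ln 2 - lnt k x)%:E) @ \oo --> log_defect x.
Proof.
rewrite /log_defect le_eqVlt => /orP[/eqP <-|x0].
  rewrite /= lexx /=; apply/cvgeryP.
  rewrite (_ : (fun _ => _) = (fun k => ln 2 + k%:R)).
    apply/cvgryPge => A; near=> k; rewrite -lerBlDl.
    by near: k; exact: nbhs_infty_ger.
  apply/funext => k; rewrite /lnt (max_idPr (expR_ge0 _)) expRK opprK//.
rewrite lne_EFin// -EFinB; apply: cvg_near_cst.
near=> k; rewrite /lnt (max_idPl _)//.
rewrite -[leRHS]lnK ?posrE// ler_expR lerNl.
by near: k; exact: nbhs_infty_ger.
Unshelve. all: by end_near. Qed.

Let log_defect_le w : cmod w <= 1 ->
  (0 <= mean_add1 log_defect w)%E /\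
  (mean_add1 log_defect w <= (4 * pi * ln 2)%:E)%E.
Proof.
move=> w1; split.
  by apply: integral_ge0 => t _; rewrite log_defect_ge0// le_cmod_add1.
have cvgI : (fun k => mean_add1 (trunc k) w) @ \oo --> mean_add1 log_defect w.
  rewrite (_ : mean_add1 log_defect w = \int[mu]_(t in circle)
      limn (fun k => trunc k (cmod (1 + w * cis t))%R))%E.
    apply: cvg_monotone_convergence => //.
    - by move=> k; apply: measurable_funTS; exact: measurable_add1.
    - by move=> k t _; rewrite trunc_ge0// le_cmod_add1.
    - move=> t _ k k' kk'; rewrite lee_fin lerD2l lerN2.
      rewrite ler_ln ?posrE ?lt_max ?expR_gt0 ?orbT// ge_max !le_max lexx /=.
      by rewrite ler_expR lerN2 ler_nat kk' orbT.
  apply: eq_integral => t _; apply/esym/cvg_lim => //.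
  by apply: cvg_lnt; exact: cmod_ge0.
rewrite -(cvg_lim _ cvgI)//; apply: lime_le.
  by apply/cvg_ex; exists (mean_add1 log_defect w).
by apply: nearW => k; exact: (trunc_le k w1).2.
Qed.

Let log_defect_double w : cmod w <= 1 ->
  (mean_add1 log_defect w + mean_add1 log_defect w =
   mean_add1 log_defect (- w ^+ 2)%R + (2 * pi * ln 2)%:E)%E.
Proof.
have mL := measurable_log_defect; have L0 := log_defect_ge0.
move=> w1; rewrite mean_add1_double ?mean_add1_sqr//.
have prod2 t : cmod (1 + w * cis t) * cmod (1 + w * - cis t) <= 2.
  by rewrite -cmodM mul_add1 -cis_sqr le_cmod_add1// cmodNsqr_le1.
rewrite -circle_cst -ge0_integralD//=; last 2 first.
- by move=> t _; exact: L0.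
- apply: measurable_funTS; apply: (measurableT_comp mL).
  under eq_fun do rewrite -cmodM mul_add1 -cis_sqr.
  apply: measurable_cmod; apply: cmeasurableD; first exact: cmeasurable_cst.
  apply: cmeasurableM; first exact: cmeasurable_cst.
  by apply: cmeasurable_cis; exact: measurable_funM.
apply: eq_integral => t _; rewrite /log_defect lneMr ?cmod_ge0//.
have gen (c : R) (A B : \bar R) : A != +oo%E -> B != +oo%E ->
    (c%:E - A + (c%:E - B) = c%:E - (A + B) + c%:E)%E.
  case: A => [a| |] //; case: B => [b| |] // _ _.
  by rewrite -EFinD -!EFinB -!EFinD; congr (_%:E); ring.
have nley x : lne x%:E != +oo%E by move=> /=; case: ifP.
by apply: gen; exact: nley.
Qed.

(** The excess of the mean over 2 pi ln 2 doubles under w -> - w^2 and is bounded,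
    hence it vanishes. *)
Lemma mean_log_defect w : cmod w <= 1 ->
  mean_add1 log_defect w = (2 * pi * ln 2)%:E.
Proof.
have l2 : 0 < ln 2 :> R by rewrite ln_gt0// ltr1n.
have fin v : cmod v <= 1 -> mean_add1 log_defect v \is a fin_num.
  by move=> /log_defect_le[v0 v1]; rewrite ge0_fin_numE// (le_lt_trans v1)// ltry.
move=> w1; rewrite -(fineK (fin _ w1)); congr EFin.
have E v : cmod v <= 1 -> 2 * fine (mean_add1 log_defect v) =
    fine (mean_add1 log_defect (- v ^+ 2)) + 2 * pi * ln 2.
  move=> v1; apply: EFin_inj.
  by rewrite mulrDl mul1r !EFinD !fineK ?fin ?cmodNsqr_le1// log_defect_double.
have bnd v : cmod v <= 1 -> 0 <= fine (mean_add1 log_defect v) <= 4 * pi * ln 2.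
  move=> v1; have [v2 v3] := log_defect_le v1.
  by rewrite -!lee_fin !fineK ?fin// v2.
apply/eqP; rewrite -subr_eq0 eq_le; apply/andP; split.
  apply: (@doubling_excess_le0 _ _ (fun v => cmod v <= 1) (fun v => - v ^+ 2)
    (fun v => fine (mean_add1 log_defect v) - 2 * pi * ln 2) 0 (4 * pi * ln 2)
    cmodNsqr_le1 _ _ w w1) => v v1.
    have /andP[_] := bnd _ v1; have : 0 < 2 * pi * ln 2 :> R by rewrite !mulr_gt0.
    by lra.
  by have := E _ v1; lra.
rewrite -oppr_le0.
apply: (@doubling_excess_le0 _ _ (fun v => cmod v <= 1) (fun v => - v ^+ 2)
  (fun v => - (fine (mean_add1 log_defect v) - 2 * pi * ln 2)) 0 (2 * pi * ln 2)
  cmodNsqr_le1 _ _ w w1) => v v1.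
  by have /andP[+ _] := bnd _ v1; lra.
by have := E _ v1; lra.
Qed.

End Jensen.

(** * Logarithmic means of polynomials *)
Section LogMean.
Local Open Scope classical_set_scope.
Variable R : realType.
Local Notation mu := (@lebesgue_measure R).
Local Notation circle := `[0%R, (2 * pi)%R].
Implicit Types (f g : R -> R) (al : R[i]) (P Q : {poly R[i]}).

Let pi0 : (0 : R) < pi := pi_gt0 R.

(** Integrability is included in order that the means of the factors of a product
    add up. *)
Definition has_logmean f (v : R) :=
  mu.-integrable circle (fun t => lne (f t)%:E) /\
  (\int[mu]_(t in circle) lne (f t)%:E = (2 * pi * v)%:E)%E.

Lemma eq_logmean f g v : f =1 g -> has_logmean f v -> has_logmean g v.
Proof. by move=> /funext ->. Qed.

Lemma logmean_uniq f u v : has_logmean f u -> has_logmean f v -> u = v.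
Proof.
move=> [_ Iu] [_]; rewrite Iu => -[/mulfI]; apply.
by rewrite mulf_neq0// gt_eqF.
Qed.

Lemma logmean_cst c : 0 < c -> has_logmean (fun=> c) (ln c).
Proof.
move=> c0; rewrite /has_logmean lne_EFin//; split; last exact: circle_cst.
exact: integrable_cst_circle.
Qed.

Lemma logmeanM f g u v : (forall t, 0 <= f t) -> (forall t, 0 <= g t) ->
  has_logmean f u -> has_logmean g v ->
  has_logmean (fun t => f t * g t) (u + v).
Proof.
move=> f0 g0 [intf If] [intg Ig].
have E : (fun t => lne (f t * g t)%:E) =
    (fun t => (lne (f t)%:E + lne (g t)%:E)%E) by apply/funext => t; exact: lneMr.
rewrite /has_logmean E; split; first exact: integrableD.
by rewrite integralD// (mulrDr (2 * pi)) EFinD -If -Ig.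
Qed.

Lemma le_logmean f g u v : (forall t, f t <= g t) ->
  has_logmean f u -> has_logmean g v -> u <= v.
Proof.
move=> fg [intf If] [intg Ig].
have : (\int[mu]_(t in circle) lne (f t)%:E <=
        \int[mu]_(t in circle) lne (g t)%:E)%E.
  by apply: le_integral => // t _; exact: lne_le.
by rewrite If Ig lee_fin ler_pM2l// mulr_gt0.
Qed.

(** For c above ln f the integrand is nonnegative, as Tonelli's theorem
    requires. *)
Lemma logmean_compl f v c : has_logmean f v ->
  (\int[mu]_(t in circle) (c%:E - lne (f t)%:E) = (2 * pi * (c - v))%:E)%E.
Proof.
move=> [intf If]; rewrite integralB//; last exact: integrable_cst_circle.
by rewrite circle_cst If -EFinB mulrBr.
Qed.

Lemma logmean_add1 w : cmod w <= 1 ->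
  has_logmean (fun t => cmod (1 + w * cis t)) 0.
Proof.
move=> w1; pose d t := log_defect (cmod (1 + w * cis t)).
have intd : mu.-integrable circle d.
  apply/integrableP; split.
    apply: measurable_funTS; apply: measurable_add1.
    exact: measurable_log_defect.
  under eq_integral => t _ do rewrite gee0_abs ?log_defect_ge0 ?le_cmod_add1//.
  by rewrite -/(mean_add1 _ w) mean_log_defect// ltry.
have E : (fun t => lne (cmod (1 + w * cis t))%:E) =
    (fun t => ((ln 2)%:E - d t)%E).
  by apply/funext => t; rewrite /d /log_defect oppeB// addeA subee// add0e.
rewrite /has_logmean E; split.
  apply: integrableB => //; exact: integrable_cst_circle.
rewrite integralB//; last exact: integrable_cst_circle.
by rewrite circle_cst -/(mean_add1 _ w) mean_log_defect// -EFinB subrr mulr0.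
Qed.

(** Jensen's formula for a z + b: dividing by the larger coefficient, and
    reflecting the factor if this is a, leaves 1 + w z with |w| <= 1. *)
Lemma logmean_lfac (p : R[i] * R[i]) : p != (0, 0) ->
  has_logmean (fun t => cmod (lfac p).[cis t])
    (ln (Num.max (cmod p.1) (cmod p.2))).
Proof.
have base (a b : R[i]) : b != 0 -> cmod a <= cmod b ->
    has_logmean (fun t => cmod (lfac (a, b)).[cis t]) (ln (cmod b)).
  move=> b0 ab; have b1 : 0 < cmod b by rewrite cmod_gt0.
  rewrite -[ln _]addr0.
  apply: (eq_logmean (f := fun t => cmod b * cmod (1 + a / b * cis t))).
    move=> t; rewrite -cmodM lfacE /=; congr cmod.
    by field.
  apply: logmeanM => //.
  - by move=> t; exact: cmod_ge0.
  - by move=> t; exact: cmod_ge0.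
  - exact: logmean_cst.
  apply: logmean_add1; rewrite cmodM cmodV ler_pdivrMr// mul1r//.
case: p => a b p0 /=; have [ab|ba] := leP (cmod a) (cmod b).
  apply: base => //; apply: contraNneq p0 => b0.
  rewrite xpair_eqE b0 eqxx andbT -cmod_eq0 eq_le cmod_ge0 andbT.
  by move: ab; rewrite b0 cmod0.
have a0 : a != 0 by rewrite -cmod_gt0 (le_lt_trans (cmod_ge0 b)).
rewrite -(cmod_conj a).
apply: (eq_logmean (f := fun t => cmod (lfac (conjc b, conjc a)).[cis t])).
  move=> t; have := @cmod_lfac_reflect _ (conjc b, conjc a) _ (cmod_cis t).
  by rewrite /reflect_fac /= !cmod_conj ba !conjcK => ->.
apply: base; first by rewrite conjc_eq0.
by rewrite !cmod_conj ltW.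
Qed.

Lemma logmean_lprod (l : seq (R[i] * R[i])) :
  (forall p, p \in l -> p != (0, 0)) ->
  has_logmean (fun t => cmod (lprod l).[cis t])
    (\sum_(p <- l) ln (Num.max (cmod p.1) (cmod p.2))).
Proof.
elim: l => [|p l ih] lP.
  rewrite big_nil -ln1; apply: (eq_logmean (f := fun=> 1)).
    by move=> t; rewrite /lprod big_nil hornerE cmod1.
  exact: logmean_cst.
rewrite big_cons; apply: (eq_logmean
  (f := fun t => cmod (lfac p).[cis t] * cmod (lprod l).[cis t])).
  by move=> t; rewrite lprod_cons hornerM cmodM.
apply: logmeanM => //; try by move=> t; exact: cmod_ge0.
  by apply: logmean_lfac; apply: lP; rewrite mem_head.
by apply: ih => q ql; apply: lP; rewrite inE ql orbT.
Qed.

Lemma logmeanZ (c : R[i]) P v : c != 0 ->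
  has_logmean (fun t => cmod P.[cis t]) v ->
  has_logmean (fun t => cmod (c *: P).[cis t]) (ln (cmod c) + v).
Proof.
move=> c0 hP.
apply: (eq_logmean (f := fun t => cmod c * cmod P.[cis t])).
  by move=> t; rewrite hornerZ cmodM.
apply: logmeanM => //; try by move=> t; exact: cmod_ge0.
by apply: logmean_cst; rewrite cmod_gt0.
Qed.

Lemma poly_logmean P : P != 0 -> exists v, has_logmean (fun t => cmod P.[cis t]) v.
Proof.
move=> P0; have [c [l [-> c0 _ lP]]] := poly_lprod (leqnSn (size P)) P0.
by eexists; apply: logmeanZ => //; exact: logmean_lprod.
Qed.

(** A factor z - r with |r| <= 1 contributes ln (max 1 |r|) = 0 to Jensen's
    formula. *)
Lemma logmean_lead P : P != 0 -> (forall z, 1 < cmod z -> P.[z] != 0) ->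
  has_logmean (fun t => cmod P.[cis t]) (ln (cmod (lead_coef P))).
Proof.
move=> P0 Pz; have [rs Prs] := closed_field_poly_normal P.
have c0 : lead_coef P != 0 by rewrite lead_coef_eq0.
pose l := [seq (1, - r) | r <- rs] : seq (R[i] * R[i]).
have Pl : P = lead_coef P *: lprod l.
  rewrite {1}Prs; congr (_ *: _); rewrite /lprod big_map; apply: eq_bigr => r _.
  by rewrite /lfac /= scale1r polyCN.
rewrite {1}Pl -[X in has_logmean _ X]addr0; apply: logmeanZ => //.
have -> : 0 = \sum_(p <- l) ln (Num.max (cmod p.1) (cmod p.2)).
  rewrite big_map big_seq big1// => r rrs.
  change (ln (Num.max (cmod (1 : R[i])) (cmod (- r))) = 0).
  suff r1 : cmod r <= 1 by rewrite cmodN cmod1 (max_idPl r1) ln1.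
  rewrite leNgt; apply/negP => /Pz/negP; apply.
  by rewrite -rootE Prs rootZ// root_prod_XsubC.
apply: logmean_lprod => p /mapP[r _ ->].
by rewrite xpair_eqE oner_eq0.
Qed.

(** The inequality for Mahler measures. Reflecting the roots of Q into the closed
    disk does not change |Q| on the circle and can only increase the modulus of
    the image under the operator there; after it, both means are the logarithms
    of leading coefficients. *)
Lemma logmean_op1_le n al Q u v : (0 < n)%N -> complex.Re al <= n%:R / 2 ->
  (size Q <= n.+1)%N -> Q != 0 ->
  has_logmean (fun t => cmod Q.[cis t]) u ->
  has_logmean (fun t => cmod (op1 al Q).[cis t]) v ->
  v <= ln (cmod (n%:R - al)) + u.
Proof.
move=> n0 al_le sQ Q0 hu hv.
have [c [l [Ql c0 sl lP]]] := poly_lprod sQ Q0.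
pose l' := map (@reflect_fac R) l; pose Q' := c *: lprod l'.
have nal := nat_sub_neq0 n0 al_le.
have sl' : size l' = n by rewrite size_map.
have l'P p : p \in l' -> p.1 != 0 /\ cmod p.2 <= cmod p.1.
  move=> /mapP[q /lP q0 ->]; split; last exact: reflect_fac_le.
  rewrite -cmod_gt0 reflect_fac_max lt_max !cmod_gt0.
  by move: q0; case: (q) => a b; rewrite xpair_eqE negb_and.
have lead' : Q'`_n = c * \prod_(p <- l') p.1.
  by rewrite coefZ -sl' (coef_lprod l').2.
have lead'0 : Q'`_n != 0.
  rewrite lead' mulf_neq0// prodf_seq_neq0; apply/allP => p /l'P[].
  by move=> p0 _; rewrite p0.
have sQ' : size Q' = n.+1.
  apply/eqP; rewrite eqn_leq; apply/andP; split.
    by rewrite (leq_trans (size_scale_leq _ _))// -sl' (coef_lprod l').1.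
  by rewrite ltnNge; apply: contra lead'0 => h; rewrite nth_default.
have sop := size_op1 nal sQ'.
have opQ'0 : op1 al Q' != 0 by rewrite -size_poly_gt0 sop.
have hv' : has_logmean (fun t => cmod (op1 al Q').[cis t])
    (ln (cmod (lead_coef (op1 al Q')))).
  apply: logmean_lead => // z z1; rewrite op1Z hornerZ mulf_neq0//.
  by apply: op1_lprod_neq0; rewrite ?sl'.
have vle : v <= ln (cmod (lead_coef (op1 al Q'))).
  apply: le_logmean hv hv' => t; rewrite Ql !op1Z !hornerZ !cmodM.
  rewrite ler_wpM2l ?cmod_ge0//; apply: op1_reflect_le => //.
  - exact: cmod_cis.
  - by rewrite sl; lra.
apply: (le_trans vle); rewrite /lead_coef sop /= coef_op1 cmodM.
rewrite lnM ?posrE ?cmod_gt0// lerD2l.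
have hu' := logmeanZ c0 (logmean_lprod lP).
have -> : u = ln (cmod c) + \sum_(p <- l) ln (Num.max (cmod p.1) (cmod p.2)).
  by apply: logmean_uniq hu _; rewrite Ql.
have prod0 : \prod_(p <- l') p.1 != 0.
  by move: lead'0; rewrite lead' mulf_eq0 negb_or => /andP[].
rewrite lead' cmodM lnM ?posrE ?cmod_gt0// lerD2l.
move: prod0; rewrite big_map {lead' lead'0 hu' Ql vle hv' hv hu sl sl' l'P sQ'
  sop opQ'0}; elim: l lP @l' @Q' => [|p l ih] lP l' Q'.
  by rewrite !big_nil cmod1 ln1.
rewrite !big_cons mulf_eq0 negb_or => /andP[p0 l0].
rewrite cmodM lnM ?posrE ?cmod_gt0// reflect_fac_max lerD2l.
by apply: ih => // q ql; apply: lP; rewrite inE ql orbT.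
Qed.

End LogMean.

(** * Iterated integrals over measurable sets *)
Section Tonelli.
Local Open Scope classical_set_scope.
Variable R : realType.
Local Notation mu := (@lebesgue_measure R).
Variables (f : R * R -> \bar R) (A B : set R).
Hypotheses (mA : measurable A) (mB : measurable B).
Hypotheses (mf : measurable_fun [set: R * R] f) (f0 : forall z, (0 <= f z)%E).

Let g := f \_ (A `*` B).

Let mg : measurable_fun [set: R * R] g.
Proof.
apply/(measurable_restrictT f); first exact: measurableX.
exact: measurable_funTS.
Qed.

Let g0 z : (0 <= g z)%E.
Proof. by rewrite /g patchE; case: ifPn. Qed.

Let gE (x y : R) : g (x, y) = if (x \in A) && (y \in B) then f (x, y) else 0%E.
Proof. by rewrite /g patchE in_setX. Qed.

Let int_snd x : x \in A -> (\int[mu]_(y in B) f (x, y) = \int[mu]_y g (x, y))%E.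
Proof.
move=> xA; rewrite integral_mkcond; apply: eq_integral => y _.
by rewrite gE patchE xA.
Qed.

Let int_snd_fst :
  (\int[mu]_(x in A) \int[mu]_(y in B) f (x, y) =
   \int[mu]_x \int[mu]_y g (x, y))%E.
Proof.
rewrite integral_mkcond; apply: eq_integral => x _.
rewrite patchE; case: ifPn => xA; first exact: int_snd.
by rewrite integral0_eq// => y _; rewrite gE (negbTE xA).
Qed.

Let int_fst_snd :
  (\int[mu]_(y in B) \int[mu]_(x in A) f (x, y) =
   \int[mu]_y \int[mu]_x g (x, y))%E.
Proof.
rewrite integral_mkcond; apply: eq_integral => y _.
rewrite patchE; case: ifPn => yB; last first.
  by rewrite integral0_eq// => x _; rewrite gE (negbTE yB) andbF.
rewrite integral_mkcond; apply: eq_integral => x _.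
by rewrite gE patchE yB andbT.
Qed.

Lemma measurable_integral_snd :
  measurable_fun A (fun x => (\int[mu]_(y in B) f (x, y))%E).
Proof.
apply: (eq_measurable_fun (fun x => (\int[mu]_y g (x, y))%E)).
  by move=> x xA; rewrite int_snd.
apply: measurable_funTS.
exact: (@measurable_fun_fubini_tonelli_F _ _ (measurableTypeR R)
  (measurableTypeR R) R mu g mg g0).
Qed.

Lemma measurable_integral_fst :
  measurable_fun B (fun y => (\int[mu]_(x in A) f (x, y))%E).
Proof.
apply: (eq_measurable_fun (fun y => (\int[mu]_x g (x, y))%E)).
  move=> y yB; rewrite [RHS]integral_mkcond; apply: eq_integral => x _.
  by rewrite gE patchE yB andbT.
apply: measurable_funTS.
exact: (@measurable_fun_fubini_tonelli_G _ _ (measurableTypeR R)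
  (measurableTypeR R) R mu g mg g0).
Qed.

(** Extending the integrand by zero reduces this to Tonelli's theorem on the whole
    plane. *)
Lemma tonelli_swap :
  (\int[mu]_(x in A) \int[mu]_(y in B) f (x, y) =
   \int[mu]_(y in B) \int[mu]_(x in A) f (x, y))%E.
Proof.
rewrite int_snd_fst int_fst_snd.
exact: (@fubini_tonelli _ _ (measurableTypeR R) (measurableTypeR R) R
  mu mu g mg g0).
Qed.

End Tonelli.

(** * Powers as superpositions of logarithms *)
Section PowerIntegral.
Local Open Scope classical_set_scope.
Variable R : realType.
Local Notation mu := (@lebesgue_measure R).
Implicit Types x s p v : R.

(** The positive part of the logarithm, written so that x = 0 gives 0. *)
Definition lnp x := ln (Num.max x 1).

Lemma lnp_ge0 x : 0 <= lnp x.
Proof. by rewrite ln_ge0// le_max lexx orbT. Qed.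

Lemma lnp_expR v : lnp (expR v) = Num.max v 0.
Proof.
rewrite /lnp; have [v0|v0] := leP 0 v.
  by rewrite (max_idPl _) ?expRK// -[leLHS]expR0 ler_expR.
by rewrite (max_idPr _) ?ln1// -[leRHS]expR0 ler_expR ltW.
Qed.

Lemma lnp0 : lnp 0 = 0.
Proof. by rewrite /lnp (max_idPr _)// ln1. Qed.

Lemma lnp_le x c : 0 <= c -> x <= expR c -> lnp x <= c.
Proof.
move=> c0 xc; rewrite -[leRHS]expRK ler_ln ?posrE ?expR_gt0 ?lt_max ?ltr01 ?orbT//.
by rewrite ge_max xc /= -[leLHS]expR0 ler_expR.
Qed.

Let G (y : R) := (y + 1) * expR (- y).

(** From 1 + y / 2 <= exp (y / 2) follows G y <= 2 exp (- y / 2). *)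
Let cvgG : G y @[y --> +oo] --> 0.
Proof.
have h : (fun y => 2 * expR (- (2^-1 * y))) @ +oo --> (2 * 0 : R).
  apply: cvgM; first exact: cvg_cst.
  apply: (@cvg_comp _ _ _ (fun y => 2^-1 * y) (fun y => expR (- y)) _
    (pinfty_nbhs R)).
    by apply: gt0_cvgMry => //; exact: cvg_id.
  exact: cvgr_expR.
rewrite mulr0 in h.
apply: (squeeze_cvgr _ (cvg_cst 0) h).
near=> y; have y0 : 0 <= y by near: y; exact: nbhs_pinfty_ge.
rewrite /G; apply/andP; split; first by rewrite mulr_ge0 ?addr_ge0 ?expR_ge0.
have := expR_ge1Dx (2^-1 * y).
rewrite (_ : expR (- y) = expR (- (2^-1 * y)) * expR (- (2^-1 * y))); last first.
  by rewrite -expRD; congr expR; field.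
have -> : expR (2^-1 * y) = (expR (- (2^-1 * y)))^-1 by rewrite expRN invrK.
have := expR_gt0 (- (2^-1 * y)); move: (expR _) => e e0 h1.
rewrite mulrA ler_wpM2r ?(ltW e0)//.
have : (1 + 2^-1 * y) * e <= 1 by rewrite -ler_pdivlMr// mul1r.
nra.
Unshelve. all: by end_near. Qed.

(** An antiderivative of (v + s) exp (- p s) in s. *)
Let F p v : R -> R :=
  - p^-1 *: ((id + cst (v + p^-1)) * (expR \o (- p *: id))).

(** Through G, whose limit at infinity is known. *)
Let FE p v s : 0 < p -> F p v s = - (expR (p * v) / p ^+ 2 * G (p * (v + s))).
Proof.
move=> p0; have pn : p != 0 by rewrite gt_eqF.
change (- p^-1 * ((s + (v + p^-1)) * expR (- p * s)) =
  - (expR (p * v) / p ^+ 2 * ((p * (v + s) + 1) * expR (- (p * (v + s)))))).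
rewrite (_ : expR (- p * s) = expR (p * v) * expR (- (p * (v + s)))).
  by field.
by rewrite -expRD; congr expR; ring.
Qed.

Let dF p v s : 0 < p -> is_derive s 1 (F p v) ((v + s) * expR (- p * s)).
Proof.
move=> p0; have pn : p != 0 by rewrite gt_eqF.
apply: is_derive_eq.
change (- p^-1 * ((s + (v + p^-1)) * (expR (- p * s) * (- p * 1)) +
  expR (- p * s) * (1 + 0)) = (v + s) * expR (- p * s)).
by field.
Qed.

Let cf p v : continuous (fun s : R => (v + s) * expR (- p * s)).
Proof.
move=> s; apply: cvgM; first by apply: cvgD; [exact: cvg_cst|exact: cvg_id].
apply: continuous_comp; last exact: continuous_expR.
by apply: cvgM; [exact: cvg_cst|exact: cvg_id].
Qed.

Lemma measurable_lnp : measurable_fun [set: R] lnp.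
Proof.
by apply: (measurableT_comp (@measurable_ln R)); exact: measurable_maxr.
Qed.

Let tail_integral p v : 0 < p ->
  (\int[mu]_(s in `[(- v)%R, +oo[) ((v + s) * expR (- p * s))%:E =
   (expR (p * v) / p ^+ 2)%:E)%E.
Proof.
move=> p0.
rewrite (@ge0_continuous_FTC2y _ _ (F p v) _ 0).
- rewrite FE// subrr /G mulr0 oppr0 expR0 add0r !mulr1 ?add0e.
  by rewrite EFinN oppeK add0r mulr1.
- move=> s vs; rewrite mulr_ge0 ?expR_ge0//; lra.
- by apply: continuous_subspaceT => s; exact: cf.
- rewrite -oppr0 -(mulr0 (expR (p * v) / p ^+ 2)).
  rewrite (_ : F p v = fun s => - (expR (p * v) / p ^+ 2 * G (p * (v + s)))).
    apply: cvgN; apply: cvgM; first exact: cvg_cst.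
    apply: (@cvg_comp _ _ _ (fun s => p * (v + s)) G _ (pinfty_nbhs R)) => //.
    apply: gt0_cvgMry => //; under eq_fun do rewrite addrC.
    exact: cvg_addrr.
  by apply/funext => s; exact: FE.
- by move=> s _; have := @dF p v s p0 => -[].
- apply: cvg_at_right_filter.
  apply: differentiable_continuous; apply/derivable1_diffP.
  by have := @dF p v (- v) p0 => -[].
- by move=> s _; rewrite derive1E; have := @dF p v s p0 => -[].
Qed.

(** With v = ln x the integrand is (v + s) exp (- p s) for s >= - v and 0
    elsewhere. As the weights exp (- p s) are positive, inequalities between means
    of lnp pass to means of powers. *)
Lemma powR_integral p x : 0 < p -> 0 <= x ->
  ((x `^ p)%:E =
   (p ^+ 2)%:E * \int[mu]_s (lnp (x * expR s) * expR (- p * s))%:E)%E.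
Proof.
move=> p0; have pn : p != 0 by rewrite gt_eqF.
rewrite le_eqVlt => /orP[/eqP <-|x0].
  rewrite powR0// integral0_eq ?mule0// => s _.
  by rewrite mul0r lnp0 mul0r.
have -> : x `^ p = expR (p * ln x) by rewrite /powR gt_eqF.
rewrite (_ : (\int[mu]_s _)%E = (expR (p * ln x) / p ^+ 2)%:E).
  by rewrite -EFinM; congr EFin; field.
rewrite -tail_integral// [RHS]integral_mkcond; apply: eq_integral => s _.
rewrite patchE mem_setE in_itv /= andbT.
have -> : x * expR s = expR (ln x + s) by rewrite expRD lnK.
rewrite lnp_expR; case: ifPn => h.
  by rewrite (max_idPl _)//; lra.
by rewrite (max_idPr _) ?mul0r//; lra.
Qed.

End PowerIntegral.

(** * The inequality for the positive part of the logarithm *)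
Section CircleInequalities.
Local Open Scope classical_set_scope.
Variable R : realType.
Local Notation mu := (@lebesgue_measure R).
Local Notation circle := `[0%R, (2 * pi)%R].
Implicit Types (al : R[i]) (P Q : {poly R[i]}) (c p s t : R).

Let pi2 : (0 : R) < 2 * pi.
Proof. by rewrite mulr_gt0// pi_gt0. Qed.

Lemma poly_bounded P : exists B, forall t, cmod P.[cis t] <= B.
Proof.
elim/poly_ind: P => [|P a [B PB]].
  by exists 0 => t; rewrite horner0 cmod0.
exists (B + cmod a) => t; rewrite hornerMXaddC (le_trans (cmodD _ _))//.
by rewrite lerD2r cmodM cmod_cis mulr1.
Qed.

Lemma integral_lneNy c :
  (\int[mu]_(t in circle) (c%:E - lne 0%:E) = +oo)%E.
Proof.
under eq_integral do rewrite le0_lneNy// /=.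
rewrite integral_cst; last exact: measurable_itv.
rewrite [X in (_ * X)%E](_ : _ = (2 * pi)%:E); last exact: circle_measure.
by rewrite gt0_mulye// lte_fin.
Qed.

(** The inequality for Mahler measures, put so that it also holds if Q or its
    image is the zero polynomial: the integrals are then +oo. *)
Lemma compl_op1_le n al Q c : (0 < n)%N -> complex.Re al <= n%:R / 2 ->
  (size Q <= n.+1)%N ->
  (\int[mu]_(t in circle) (c%:E - lne (cmod Q.[cis t])%:E) <=
   \int[mu]_(t in circle)
     ((c + ln (cmod (n%:R - al)))%:E - lne (cmod (op1 al Q).[cis t])%:E))%E.
Proof.
move=> n0 al_le sQ.
have zero (T : {poly R[i]}) b : T = 0 ->
    (\int[mu]_(t in circle) (b%:E - lne (cmod T.[cis t])%:E) = +oo)%E.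
  move=> ->; rewrite -(integral_lneNy b); apply: eq_integral => t _.
  by rewrite horner0 cmod0.
have [Q0|Q0] := eqVneq Q 0; first by rewrite (zero (op1 al Q)) ?leey// Q0 op10.
have [T0|T0] := eqVneq (op1 al Q) 0; first by rewrite (zero _ _ T0) leey.
have [u hu] := poly_logmean Q0; have [v hv] := poly_logmean T0.
rewrite (logmean_compl _ hu) (logmean_compl _ hv) lee_fin ler_pM2l//.
have := logmean_op1_le n0 al_le sQ Q0 hu hv; lra.
Qed.

Lemma lnp_div (x k : R) : 0 < k -> lnp (x / k) = ln (Num.max k x) - ln k.
Proof.
move=> k0; have -> : Num.max k x = k * Num.max (x / k) 1.
  by rewrite maxr_pMr ?ltW// mulr1 mulrCA divff ?gt_eqF// mulr1 maxC.
rewrite lnM ?posrE// ?lt_max ?ltr01 ?orbT//.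
by rewrite addrAC subrr add0r.
Qed.

Lemma measurable_lnp_cmod P : measurable_fun [set: R]
  (fun t => lnp (cmod P.[cis t])).
Proof.
apply: (measurableT_comp (@measurable_lnp R)).
by apply: measurable_cmod; apply: cmeasurable_horner; exact: cmeasurable_cis.
Qed.

Lemma integral_compl (u : R -> R) c : measurable_fun [set: R] u ->
  (forall t, 0 <= u t <= c) ->
  (\int[mu]_(t in circle) (u t)%:E \is a fin_num)%E /\
  (\int[mu]_(t in circle) (2 * pi * (c - u t))%:E =
   (2 * pi * (2 * pi * c - fine (\int[mu]_(t in circle) (u t)%:E)))%:E)%E.
Proof.
move=> mu_ uc.
have intu : mu.-integrable circle (EFin \o u).
  have fin : (mu circle < +oo)%E by rewrite circle_measure ltry.
  apply: (measurable_bounded_integrable _ fin) => //.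
    exact: measurable_funTS.
  exists c; split; first exact: num_real.
  move=> M cM t _ /=.
  by have /andP[u0 uc'] := uc t; rewrite ger0_norm// (le_trans uc')// ltW.
have fin : (\int[mu]_(t in circle) (u t)%:E \is a fin_num)%E.
  by apply: integrable_fin_num.
split=> //.
under eq_integral => t _ do rewrite EFinM EFinB.
rewrite integralZl//; last first.
  by apply: integrableB => //; exact: integrable_cst_circle.
rewrite integralB//; last exact: integrable_cst_circle.
by rewrite circle_cst -(fineK fin) -EFinB -EFinM.
Qed.

(** The inequality for the positive part of the logarithm. By Jensen's formula
    lnp |a| is the mean over s of ln |a + e^(is)|; multiplying e^(is) by z^n on
    the circle changes nothing, and z^n is an eigenvector of the operator, so
    that the inequality is an average of those for the Mahler measures of
    P + e^(is) z^n. *)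
Lemma lnp_op1_le n al P : (0 < n)%N -> complex.Re al <= n%:R / 2 ->
  (size P <= n.+1)%N ->
  (\int[mu]_(t in circle)
     (lnp (cmod (op1 al P).[cis t] / cmod (n%:R - al)))%:E <=
   \int[mu]_(t in circle) (lnp (cmod P.[cis t]))%:E)%E.
Proof.
move=> n0 al_le sP; have k0 := nat_sub_neq0 n0 al_le.
set k := cmod _; have {}k0' : 0 < k by rewrite /k cmod_gt0.
have [B1 PB] := poly_bounded P; have [B2 TB] := poly_bounded (op1 al P).
(* As 1 + x <= expR x, this c makes f and h below nonnegative. *)
pose c := Num.max B1 (B2 / k).
have cP t : cmod P.[cis t] + 1 <= expR c.
  by rewrite addrC (le_trans _ (expR_ge1Dx _))// lerD2l le_max PB.
have cT t : cmod (op1 al P).[cis t] + k <= expR (c + ln k).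
  rewrite expRD lnK ?posrE// -ler_pdivrMr// mulrDl divff ?gt_eqF//.
  rewrite addrC (le_trans _ (expR_ge1Dx _))// lerD2l le_max.
  by rewrite ler_pM2r ?invr_gt0// TB orbT.
have c0 : 0 <= c.
  by rewrite /c le_max (le_trans _ (PB 0)) ?cmod_ge0.
pose f (z : R * R) :=
  (c%:E - lne (cmod (cis z.2 ^+ n * cis z.1 + P.[cis z.2]))%:E)%E.
pose h (z : R * R) := ((c + ln k)%:E -
  lne (cmod ((n%:R - al) * cis z.2 ^+ n * cis z.1 + (op1 al P).[cis z.2]))%:E)%E.
have mf : measurable_fun [set: R * R] f.
  apply: emeasurable_funB => //; apply: measurable_lne; apply: measurable_cmod.
  apply: cmeasurableD; last first.
    by apply: cmeasurable_horner; apply: cmeasurable_cis; exact: measurable_snd.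
  apply: cmeasurableM; last by apply: cmeasurable_cis; exact: measurable_fst.
  by apply: cmeasurableX; apply: cmeasurable_cis; exact: measurable_snd.
have mh : measurable_fun [set: R * R] h.
  apply: emeasurable_funB => //; apply: measurable_lne; apply: measurable_cmod.
  apply: cmeasurableD; last first.
    by apply: cmeasurable_horner; apply: cmeasurable_cis; exact: measurable_snd.
  apply: cmeasurableM; last by apply: cmeasurable_cis; exact: measurable_fst.
  apply: cmeasurableM; first exact: cmeasurable_cst.
  by apply: cmeasurableX; apply: cmeasurable_cis; exact: measurable_snd.
have f0 z : (0 <= f z)%E.
  apply: subr_lne_ge0; rewrite (le_trans (cmodD _ _))// cmodM cmodX !cmod_cis.
  by rewrite expr1n mulr1 addrC.
have h0 z : (0 <= h z)%E.
  apply: subr_lne_ge0; rewrite (le_trans (cmodD _ _))// !cmodM cmodX !cmod_cis.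
  by rewrite expr1n !mulr1 addrC.
have fh : (\int[mu]_(s in circle) \int[mu]_(t in circle) f (s, t) <=
           \int[mu]_(s in circle) \int[mu]_(t in circle) h (s, t))%E.
  apply: ge0_le_integral => //.
  - by move=> s _; exact: integral_ge0.
  - exact: measurable_integral_snd.
  - exact: measurable_integral_snd.
  move=> s _; pose Q := P + cis s *: 'X^n.
  have sQ : (size Q <= n.+1)%N.
    rewrite (leq_trans (size_polyD _ _))// geq_max sP.
    by rewrite (leq_trans (size_scale_leq _ _))// size_polyXn.
  have fE t : f (s, t) = (c%:E - lne (cmod Q.[cis t])%:E)%E.
    by rewrite /f /Q /= hornerD hornerZ hornerXn (mulrC (cis s)) (addrC P.[_]).
  have hE t : h (s, t) = ((c + ln k)%:E - lne (cmod (op1 al Q).[cis t])%:E)%E.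
    rewrite /h /Q /= op1D op1Z op1Xn hornerD !hornerZ hornerXn.
    by rewrite (mulrC (cis s)) (addrC (op1 al P).[_]).
  under eq_integral do rewrite fE; under [leRHS]eq_integral do rewrite hE.
  exact: compl_op1_le.
(* After the exchange, Jensen's formula evaluates the integrals over s. *)
rewrite !tonelli_swap// in fh.
have inner (a b : R[i]) (d : R) : a != 0 ->
    (\int[mu]_(s in circle) (d%:E - lne (cmod (a * cis s + b))%:E) =
     (2 * pi * (d - ln (Num.max (cmod a) (cmod b))))%:E)%E.
  move=> a0; have ab : (a, b) != (0, 0) by rewrite xpair_eqE negb_and a0.
  rewrite -(logmean_compl d (logmean_lfac ab)).
  by apply: eq_integral => s _; rewrite lfacE.
have fE t : (\int[mu]_(s in circle) f (s, t) =
    (2 * pi * (c - lnp (cmod P.[cis t])))%:E)%E.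
  rewrite /f /= inner; last by rewrite expf_neq0// -cmod_gt0 cmod_cis.
  by rewrite cmodX cmod_cis expr1n /lnp maxC.
have hE t : (\int[mu]_(s in circle) h (s, t) =
    (2 * pi * (c - lnp (cmod (op1 al P).[cis t] / k)))%:E)%E.
  rewrite /h /= inner; last first.
    by rewrite mulf_neq0// expf_neq0// -cmod_gt0 cmod_cis.
  rewrite cmodM cmodX cmod_cis expr1n mulr1 -/k lnp_div//.
  by congr (_ * _)%:E; ring.
have uP t : 0 <= lnp (cmod P.[cis t]) <= c.
  by rewrite lnp_ge0 lnp_le// (le_trans _ (cP t))// lerDl.
have uT t : 0 <= lnp (cmod (op1 al P).[cis t] / k) <= c.
  rewrite lnp_ge0 lnp_le// ler_pdivrMr//.
  by have := cT t; rewrite expRD lnK ?posrE//; lra.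
have mT : measurable_fun [set: R] (fun t => lnp (cmod (op1 al P).[cis t] / k)).
  apply: (measurableT_comp (@measurable_lnp R)).
  apply: measurable_funM => //; apply: measurable_cmod.
  by apply: cmeasurable_horner; exact: cmeasurable_cis.
have [finP IP] := integral_compl (measurable_lnp_cmod P) uP.
have [finT IT] := integral_compl mT uT.
move: fh; under eq_integral do rewrite fE.
under [leRHS]eq_integral do rewrite hE.
rewrite IP IT lee_fin ler_pM2l// lerD2l lerN2 => fh.
by rewrite -(fineK finP) -(fineK finT) lee_fin.
Qed.

End CircleInequalities.

(** * The inequality for power means *)
Section PowerNorm.
Local Open Scope classical_set_scope.
Variable R : realType.
Local Notation mu := (@lebesgue_measure R).
Local Notation circle := `[0%R, (2 * pi)%R].
Implicit Types (al ga c : R[i]) (P Q : {poly R[i]}) (p s t : R).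

Let pi2 : (0 : R) < 2 * pi.
Proof. by rewrite mulr_gt0// pi_gt0. Qed.

Let measurable_cmod_horner P : measurable_fun [set: R] (fun t => cmod P.[cis t]).
Proof.
by apply: measurable_cmod; apply: cmeasurable_horner; exact: cmeasurable_cis.
Qed.

(** The integrand that represents u^p in powR_integral. *)
Let layer p (u : R -> R) (z : R * R) : \bar R :=
  (lnp (u z.1 * expR z.2) * expR (- p * z.2))%:E.

Let measurable_layer p u : measurable_fun [set: R] u ->
  measurable_fun [set: R * R] (layer p u).
Proof.
move=> mu_; apply/measurable_EFinP; apply: measurable_funM.
  apply: (measurableT_comp (@measurable_lnp R)); apply: measurable_funM.
    by apply: (measurableT_comp mu_); exact: measurable_fst.
  by apply: (measurableT_comp (@measurable_expR R)); exact: measurable_snd.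
apply: (measurableT_comp (@measurable_expR R)).
by apply: measurable_funM => //; exact: measurable_snd.
Qed.

Let layer_ge0 p u z : (0 <= layer p u z)%E.
Proof. by rewrite lee_fin mulr_ge0 ?lnp_ge0 ?expR_ge0. Qed.

Lemma integral_powR p (u : R -> R) : 0 < p -> measurable_fun [set: R] u ->
  (forall t, 0 <= u t) ->
  (\int[mu]_(t in circle) ((u t) `^ p)%:E =
   (p ^+ 2)%:E * \int[mu]_s \int[mu]_(t in circle) layer p u (t, s))%E.
Proof.
move=> p0 mu_ u0; have mf := measurable_layer p mu_.
pose g t := (\int[mu]_s layer p u (t, s))%E.
have mg : measurable_fun circle g.
  exact: (measurable_integral_snd _ _ mf (@layer_ge0 p u)).
have g0 t : (0 <= g t)%E by apply: integral_ge0 => s _; exact: layer_ge0.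
transitivity (\int[mu]_(t in circle) ((p ^+ 2)%:E * g t))%E.
  by apply: eq_integral => t _; exact: (powR_integral p0 (u0 t)).
have p2 : 0 <= p ^+ 2 by rewrite exprn_ge0 ?ltW.
have Z := @ge0_integralZl_EFin _ _ _ mu circle (measurable_itv _) g
  (fun t _ => g0 t) mg _ p2.
have S := tonelli_swap (measurable_itv _) measurableT mf (@layer_ge0 p u).
by rewrite Z /g S {Z S mf mg g0}.
Qed.

Lemma powR_op1_le n al P p : (0 < n)%N -> complex.Re al <= n%:R / 2 ->
  (size P <= n.+1)%N -> 0 < p ->
  (\int[mu]_(t in circle)
     ((cmod (op1 al P).[cis t] / cmod (n%:R - al)) `^ p)%:E <=
   \int[mu]_(t in circle) ((cmod P.[cis t]) `^ p)%:E)%E.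
Proof.
move=> n0 al_le sP p0; have k0' := nat_sub_neq0 n0 al_le.
pose k := cmod (n%:R - al); have k0 : 0 < k by rewrite /k cmod_gt0.
pose u1 t := cmod P.[cis t]; pose u2 t := cmod (op1 al P).[cis t] / k.
have mu1 : measurable_fun [set: R] u1 by exact: measurable_cmod_horner.
have mu2 : measurable_fun [set: R] u2.
  by apply: measurable_funM => //; exact: measurable_cmod_horner.
have u1_ge0 t : 0 <= u1 t by exact: cmod_ge0.
have u2_ge0 t : 0 <= u2 t by rewrite divr_ge0 ?cmod_ge0 ?ltW.
rewrite (integral_powR p0 mu1 u1_ge0) (integral_powR p0 mu2 u2_ge0).
apply: lee_wpmul2l; first by rewrite lee_fin exprn_ge0 ?ltW.
have mI u : measurable_fun [set: R] u -> measurable_fun [set: R]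
    (fun s => (\int[mu]_(t in circle) layer p u (t, s))%E).
  move=> /(measurable_layer p) mf.
  exact: (measurable_integral_fst _ _ mf (@layer_ge0 p u)).
apply: ge0_le_integral => //.
- by move=> s _; apply: integral_ge0 => t _; exact: layer_ge0.
- exact: mI.
- exact: mI.
move=> s _.
have out u : measurable_fun [set: R] u ->
    (\int[mu]_(t in circle) layer p u (t, s) =
     (expR (- p * s))%:E * \int[mu]_(t in circle) (lnp (u t * expR s))%:E)%E.
  move=> mu_; rewrite -ge0_integralZl_EFin//; last 2 first.
  - by move=> t _; rewrite lee_fin lnp_ge0.
  - apply: measurable_funTS; apply/measurable_EFinP.
    by apply: (measurableT_comp (@measurable_lnp R)); exact: measurable_funM.
  by apply: eq_integral => t _; rewrite /layer /= -EFinM mulrC.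
rewrite (out _ mu1) (out _ mu2).
apply: lee_wpmul2l; first by rewrite lee_fin expR_ge0.
(* The scalar exp s is absorbed into the polynomial. *)
pose e : R[i] := ((expR s)%:C)%C.
have e0 : cmod e = expR s by rewrite cmod_real// expR_ge0.
have := @lnp_op1_le _ n al (e *: P) n0 al_le (leq_trans (size_scale_leq _ _) sP).
congr (_ <= _)%E; apply: eq_integral => t _; congr (lnp _)%:E.
  by rewrite op1Z hornerZ cmodM e0 -mulrA mulrC.
by rewrite hornerZ cmodM e0 mulrC.
Qed.

Lemma pnorm_op1_le n al P p : (0 < n)%N -> complex.Re al <= n%:R / 2 ->
  size P = n.+1 -> 0 <= p ->
  (pnorm p (op1 al P) <= (cmod (n%:R - al))%:E * pnorm p P)%E.
Proof.
move=> n0 al_le sP p_ge0; have k0' := nat_sub_neq0 n0 al_le.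
pose k := cmod (n%:R - al); have k0 : 0 < k by rewrite /k cmod_gt0.
have P0 : P != 0 by rewrite -size_poly_gt0 sP.
have sP' : (size P <= n.+1)%N by rewrite sP.
rewrite -/k /pnorm; case: ifPn => [_|pn0].
  have T0 : op1 al P != 0 by rewrite -size_poly_gt0 (size_op1 k0' sP).
  have [u hu] := poly_logmean P0; have [v hv] := poly_logmean T0.
  rewrite hu.2 hv.2 -!EFinM !mulKf ?gt_eqF//.
  change ((expR v)%:E <= (k * expR u)%:E)%E.
  rewrite lee_fin -[X in _ <= X * _]lnK ?posrE// -expRD ler_expR.
  exact: (logmean_op1_le n0 al_le sP' P0 hu hv).
have p0 : 0 < p by rewrite lt_neqAle eq_sym pn0.
pose I (Q : {poly R[i]}) := (\int[mu]_(t in circle) ((cmod Q.[cis t]) `^ p)%:E)%E.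
have I0 Q : (0 <= I Q)%E by apply: integral_ge0 => t _; rewrite lee_fin powR_ge0.
have Ile : (I (op1 al P) <= (k `^ p)%:E * I P)%E.
  have -> : I (op1 al P) = ((k `^ p)%:E * \int[mu]_(t in circle)
      ((cmod (op1 al P).[cis t] / k) `^ p)%:E)%E.
    rewrite -ge0_integralZl_EFin//; last 3 first.
    - by move=> t _; rewrite lee_fin powR_ge0.
    - apply: measurable_funTS; apply/measurable_EFinP.
      apply: (measurableT_comp (measurable_powR p)).
      by apply: measurable_funM => //; exact: measurable_cmod_horner.
    - exact: powR_ge0.
    apply: eq_integral => t _.
    have T0 : 0 <= cmod (op1 al P).[cis t] / k by rewrite divr_ge0 ?cmod_ge0 ?ltW.
    by rewrite -EFinM -(powRM p (ltW k0) T0) mulrC divfK// gt_eqF.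
  apply: lee_wpmul2l; first by rewrite lee_fin powR_ge0.
  exact: powR_op1_le.
have c0 : 0 < (2 * pi)^-1 :> R by rewrite invr_gt0.
have kE : k%:E = ((k `^ p)%:E `^ p^-1)%E.
  by rewrite poweR_EFin -powRrM divff// powRr1// ltW.
rewrite -/(I _) -/(I _) kE -poweRM; last 2 first.
- by rewrite lee_fin powR_ge0.
- by rewrite mule_ge0// lee_fin ltW.
apply: gt0_ler_poweR.
- by rewrite invr_ge0.
- by rewrite in_itv /= leey andbT mule_ge0// lee_fin ltW.
- by rewrite in_itv /= leey andbT !mule_ge0// lee_fin ?powR_ge0// ltW.
rewrite muleCA; apply: lee_wpmul2l => //; by rewrite lee_fin ltW.
Qed.

Lemma pnormXn c n p : c != 0 -> 0 <= p -> pnorm p (c *: 'X^n) = (cmod c)%:E.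
Proof.
move=> c0 p_ge0; have cc : 0 < cmod c by rewrite cmod_gt0.
have E t : cmod (c *: 'X^n).[cis t] = cmod c.
  by rewrite hornerZ hornerXn cmodM cmodX cmod_cis expr1n mulr1.
rewrite /pnorm; case: ifPn => [_|pn0].
  under eq_integral do rewrite E lne_EFin//.
  by rewrite circle_cst -EFinM mulKf ?gt_eqF// /expeR lnK.
under eq_integral do rewrite E.
rewrite circle_cst -EFinM mulKf ?gt_eqF// poweR_EFin -powRrM divff// powRr1//.
exact: ltW.
Qed.

End PowerNorm.

(** * The sharp inequalities *)
Theorem theorem1 (R : realType) (n : nat) (alpha gamma : R[i]) (p : R)
    (n_gt0 : (0 < n)%N)
    (alpha_le : complex.Re alpha <= n%:R / 2)
    (gamma_le : complex.Re gamma <= n%:R / 2)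
    (p_ge0 : 0 <= p) :
  let K1 : R := cmod (n%:R - alpha) in
  let K2 : R := cmod (n%:R * (n%:R - alpha - gamma) + alpha * gamma) in
  (* the two inequalities *)
  (forall P : {poly R[i]}, size P = n.+1 ->
     (pnorm p (op1 alpha P) <= K1%:E * pnorm p P)%E /\
     (pnorm p (op2 alpha gamma P) <= K2%:E * pnorm p P)%E) /\
  (* equality for c z^n *)
  (forall c : R[i], c != 0 ->
     pnorm p (op1 alpha (c *: 'X^n)) = (K1%:E * pnorm p (c *: 'X^n))%E /\
     pnorm p (op2 alpha gamma (c *: 'X^n)) = (K2%:E * pnorm p (c *: 'X^n))%E) /\
  (* the constants cannot be lowered *)
  (forall C : R,
     (forall P : {poly R[i]}, size P = n.+1 ->
        (pnorm p (op1 alpha P) <= C%:E * pnorm p P)%E) -> K1 <= C) /\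
  (forall C : R,
     (forall P : {poly R[i]}, size P = n.+1 ->
        (pnorm p (op2 alpha gamma P) <= C%:E * pnorm p P)%E) -> K2 <= C).
Proof.
move=> K1 K2.
have al0 := nat_sub_neq0 n_gt0 alpha_le; have ga0 := nat_sub_neq0 n_gt0 gamma_le.
have K2E : K2 = K1 * cmod (n%:R - gamma).
  by rewrite /K2 /K1 -cmodM; congr cmod; ring.
have eq1 c : c != 0 ->
    pnorm p (op1 alpha (c *: 'X^n)) = (K1%:E * pnorm p (c *: 'X^n))%E.
  move=> c0; rewrite op1Z op1Xn scalerA !pnormXn ?mulf_neq0//.
  by rewrite cmodM EFinM muleC.
have eq2 c : c != 0 ->
    pnorm p (op2 alpha gamma (c *: 'X^n)) = (K2%:E * pnorm p (c *: 'X^n))%E.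
  move=> c0; rewrite op2E !op1Z !op1Xn op1Z op1Xn !scalerA.
  rewrite !pnormXn ?mulf_neq0// -EFinM; congr EFin.
  by rewrite K2E /K1 !cmodM; ring.
have X1 : pnorm p ('X^n : {poly R[i]}) = 1%E.
  by rewrite -[X in pnorm p X]scale1r pnormXn ?oner_neq0// cmod1.
have sX : size ('X^n : {poly R[i]}) = n.+1 by rewrite size_polyXn.
split; last split; last split.
- move=> P sP; split; first exact: pnorm_op1_le.
  (* The second operator is the composite of two of the first kind, and the
     inner one keeps the degree n. *)
  rewrite op2E K2E EFinM -muleA.
  apply: le_trans (pnorm_op1_le n_gt0 alpha_le (size_op1 ga0 sP) p_ge0) _.
  apply: lee_wpmul2l; first by rewrite lee_fin cmod_ge0.
  exact: pnorm_op1_le.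
- by move=> c c0; split; [exact: eq1|exact: eq2].
- move=> C /(_ _ sX); have := eq1 1 (oner_neq0 _).
  by rewrite scale1r => ->; rewrite X1 !mule1 lee_fin.
- move=> C /(_ _ sX); have := eq2 1 (oner_neq0 _).
  by rewrite scale1r => ->; rewrite X1 !mule1 lee_fin.
Qed.
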